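(* The assignment $E_i\mapsto R_{\sigma_i}$ for $i\in I$ extends uniquely to a surjective homomorphism of $\mathbf{Q}$-algebras $$\eta:\mathcal{U}_0^+(Q)\to\mathbf{Q}\,\mathcal{C}(Q),$$ where $\mathbf{Q}\,\mathcal{C}(Q)$ denotes the monoid ring of the monoid $\mathcal{C}(Q)$.
   Context: $k$ is an algebraically closed field of characteristic $0$, and $Q$ is a finite quiver without oriented cycles with vertex set $I$. $\mathbf{N}I$ is the set of vectors with nonnegative integer coordinates in the free abelian group on symbols $\sigma_i$ ($i\in I$). For $d\in\mathbf{N}I$, $R_d=\bigoplus_{\alpha:i\to j}\mathrm{Hom}_k(k^{d_i},k^{d_j})$ is the affine variety of representations of $Q$ of dimension vector $d$, acted on by $G_d=\prod_{i\in I}\mathrm{GL}_{d_i}(k)$ by base change. For $\mathcal{A}\subset R_d$, $\mathcal{B}\subset R_e$, the set $\mathcal{A}*\mathcal{B}\subset R_{d+e}$ consists of all $X\in R_{d+e}$ for which there is an exact sequence of representations $0\to N\to X\to M\to 0$ with $M\in\mathcal{A}$, $N\in\mathcal{B}$. The extension monoid $\mathcal{M}(Q)$ is the set of all irreducible, closed, $G_d$-stable subvarieties of all $R_d$ ($d\in\mathbf{N}I$) with operation $*$ and unit $R_0$. The composition monoid $\mathcal{C}(Q)$ is the submonoid of $\mathcal{M}(Q)$ generated by the $R_{\sigma_i}$, $i\in I$. For nonnegative integers $M,N$, set $[M]!=(q-1)(q^2-1)\cdots(q^M-1)$ and $\left[{M+N\atop M}\right]=\frac{[M+N]!}{[M]!\,[N]!}\in\mathbf{Z}[q]$.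 $\mathcal{U}^+(Q)$ is the $\mathbf{Q}[q]$-algebra with generators $E_i$ ($i\in I$) and relations $$\sum_{p+p'=n+1}(-1)^{p'}q^{p'(p'-1)}\left[{p+p'\atop p}\right]E_i^pE_jE_i^{p'}=0,\qquad \sum_{p+p'=n+1}(-1)^{p}q^{p(p-1)}\left[{p+p'\atop p}\right]E_j^pE_iE_j^{p'}=0,$$ for all $i,j\in I$ such that there is no arrow from $j$ to $i$, where $n$ is the number of arrows from $i$ to $j$. $\mathcal{U}_0^+(Q)$ is the $\mathbf{Q}$-algebra obtained from $\mathcal{U}^+(Q)$ by specializing $q$ to $0$, i.e. $\mathbf{Q}\otimes_{\mathbf{Q}[q]}\mathcal{U}^+(Q)$ with $q$ acting on $\mathbf{Q}$ as $0$. *)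

(* Defs.v *)
From HB Require Import structures.
From mathcomp Require Import all_boot all_order all_algebra.
From mathcomp Require Import boolp classical_sets.
From mathcomp Require Import monalg.
From mathcomp Require finmap mpoly.

Set Implicit Arguments.
Unset Strict Implicit.
Unset Printing Implicit Defensive.

Import GRing.Theory.
Import Quotient.

Local Open Scope ring_scope.
Local Open Scope classical_set_scope.
Local Open Scope quotient_scope.

Section FreeAlgebra.
Variables (R : comNzRingType) (I : choiceType).

Definition free_alg := {malg R[{fmonom I}]}.
HB.instance Definition _ := GRing.Lalgebra.on free_alg.

Fact free_alg_scalerAr (c : R) (x y : free_alg) :
  c *: (x * y) = x * (c *: y).
Proof.
apply/malgP=> m; rewrite mcoeffZ !mcoeffMl.
have sZ := @msuppZ_le _ _ c y; rewrite -!mcoeffMl.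
rewrite (mcoeffMlw m (finmap.fsubset_refl _) sZ) mcoeffMl mulr_sumr.
apply: eq_bigr => u _; rewrite mulr_sumr; apply: eq_bigr => v _.
by rewrite mcoeffZ mulrnAr mulrCA.
Qed.
HB.instance Definition _ := GRing.Lalgebra_isAlgebra.Build R free_alg
  free_alg_scalerAr.

Definition free_gen (i : I) : free_alg := << fmu i >>.

End FreeAlgebra.

Section QuotientAlgebra.
Variables (R : comNzRingType) (A : algType R) (rel : set A).

Inductive ideal_gen : A -> Prop :=
| ideal_gen0 : ideal_gen 0
| ideal_genD a r b x : rel r -> ideal_gen x -> ideal_gen (a * r * b + x).

Definition ideal_pred : {pred A} := [pred x | `[< ideal_gen x >]].

Lemma idealP x : reflect (ideal_gen x) (x \in ideal_pred).
Proof. exact: asboolP. Qed.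

Lemma ideal_genDr x y : ideal_gen x -> ideal_gen y -> ideal_gen (x + y).
Proof.
by elim=> [|a r b z rr _ IH] yI; rewrite ?add0r // -addrA; apply/ideal_genD/IH.
Qed.

Lemma ideal_genMl a x : ideal_gen x -> ideal_gen (a * x).
Proof.
elim=> [|c r b z rr _ IH]; first by rewrite mulr0; constructor.
by rewrite mulrDr !mulrA; constructor.
Qed.

Lemma ideal_genMr a x : ideal_gen x -> ideal_gen (x * a).
Proof.
elim=> [|c r b z rr _ IH]; first by rewrite mul0r; constructor.
by rewrite mulrDl -[_ * b * a]mulrA; constructor.
Qed.

Fact ideal_zmod_closed : zmod_closed ideal_pred.
Proof.
split=> [|x y /idealP xI /idealP yI]; apply/idealP; first exact: ideal_gen0.
by apply: ideal_genDr => //; rewrite -mulN1r; apply: ideal_genMl.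
Qed.
HB.instance Definition _ := GRing.isZmodClosed.Build A ideal_pred
  ideal_zmod_closed.

(* An algType is a nonzero ring, hence the side condition. *)
Definition quot_alg (proper : ~ ideal_gen 1) := {quot ideal_pred}.

Variable proper : ~ ideal_gen 1.
Local Notation Q := (quot_alg proper).
HB.instance Definition _ := GRing.Zmodule.on Q.
HB.instance Definition _ : EqQuotient A (equiv ideal_pred) Q := EqQuotient.on Q.

Definition quot_pi (x : A) : Q := \pi x.

Lemma quot_piP x y : quot_pi x = quot_pi y <-> ideal_gen (x - y).
Proof.
rewrite /quot_pi; split=> [/eqP|xyI]; last apply/eqP; rewrite piE equivE.
  by move/idealP.
exact/idealP.
Qed.

Lemma quot_piK (u : Q) : quot_pi (repr u) = u.
Proof. exact: reprK. Qed.

Fact quot_pi_is_zmod_morphism : zmod_morphism quot_pi.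
Proof. by move=> x y; rewrite /quot_pi !piE. Qed.
HB.instance Definition _ := GRing.isZmodMorphism.Build A Q quot_pi
  quot_pi_is_zmod_morphism.

Definition quot_mul (u v : Q) : Q := quot_pi (repr u * repr v).
Definition quot_scale (c : R) (u : Q) : Q := quot_pi (c *: repr u).

Lemma quot_piM x y : quot_pi (x * y) = quot_mul (quot_pi x) (quot_pi y).
Proof.
have /quot_piP xI : quot_pi x = quot_pi (repr (quot_pi x)) by rewrite quot_piK.
have /quot_piP yI : quot_pi y = quot_pi (repr (quot_pi y)) by rewrite quot_piK.
apply/quot_piP; set x' := repr _ in xI *; set y' := repr _ in yI *.
have ->: x * y - x' * y' = (x - x') * y + x' * (y - y').
  by rewrite mulrBl mulrBr addrA subrK.
by apply: ideal_genDr; [apply: ideal_genMr | apply: ideal_genMl].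
Qed.

Lemma quot_piZ c x : quot_pi (c *: x) = quot_scale c (quot_pi x).
Proof.
have /quot_piP xI : quot_pi x = quot_pi (repr (quot_pi x)) by rewrite quot_piK.
apply/quot_piP; rewrite -scalerBr -[_ - _]mul1r scalerAl.
exact: ideal_genMl.
Qed.

Fact quot_mulA : associative quot_mul.
Proof.
by move=> u v w; rewrite -(quot_piK u) -(quot_piK v) -(quot_piK w) -!quot_piM mulrA.
Qed.

Fact quot_mul1 : left_id (quot_pi 1) quot_mul.
Proof. by move=> u; rewrite -(quot_piK u) -quot_piM mul1r. Qed.

Fact quot_mulr1 : right_id (quot_pi 1) quot_mul.
Proof. by move=> u; rewrite -(quot_piK u) -quot_piM mulr1. Qed.

Fact quot_mulDl : left_distributive quot_mul +%R.
Proof.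
move=> u v w; rewrite -(quot_piK u) -(quot_piK v) -(quot_piK w).
by rewrite -raddfD -!quot_piM mulrDl raddfD.
Qed.

Fact quot_mulDr : right_distributive quot_mul +%R.
Proof.
move=> u v w; rewrite -(quot_piK u) -(quot_piK v) -(quot_piK w).
by rewrite -raddfD -!quot_piM mulrDr raddfD.
Qed.

Fact quot_oner_neq0 : quot_pi 1 != 0.
Proof. by apply/eqP; rewrite -[0](raddf0 quot_pi) => /quot_piP; rewrite subr0. Qed.

HB.instance Definition _ := GRing.Zmodule_isNzRing.Build Q
  quot_mulA quot_mul1 quot_mulr1 quot_mulDl quot_mulDr quot_oner_neq0.

Fact quot_scalerA a b u : quot_scale a (quot_scale b u) = quot_scale (a * b) u.
Proof. by rewrite -(quot_piK u) -!quot_piZ scalerA. Qed.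

Fact quot_scale1 : left_id 1 quot_scale.
Proof. by move=> u; rewrite -(quot_piK u) -quot_piZ scale1r. Qed.

Fact quot_scalerDr : right_distributive quot_scale +%R.
Proof.
move=> c u v; rewrite -(quot_piK u) -(quot_piK v).
by rewrite -raddfD -!quot_piZ scalerDr raddfD.
Qed.

Fact quot_scalerDl u : {morph quot_scale^~ u : a b / a + b}.
Proof. by move=> a b; rewrite -(quot_piK u) -!quot_piZ scalerDl raddfD. Qed.

HB.instance Definition _ := GRing.Zmodule_isLmodule.Build R Q
  quot_scalerA quot_scale1 quot_scalerDr quot_scalerDl.

Fact quot_scalerAl (c : R) (u v : Q) : c *: (u * v) = c *: u * v.
Proof.
rewrite -(quot_piK u) -(quot_piK v).
by rewrite -[_ * _]quot_piM -[LHS]quot_piZ scalerAl quot_piM quot_piZ.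
Qed.
HB.instance Definition _ := GRing.Lmodule_isLalgebra.Build R Q quot_scalerAl.

Fact quot_scalerAr (c : R) (u v : Q) : c *: (u * v) = u * (c *: v).
Proof.
rewrite -(quot_piK u) -(quot_piK v).
by rewrite -[_ * _]quot_piM -[LHS]quot_piZ scalerAr quot_piM quot_piZ.
Qed.
HB.instance Definition _ := GRing.Lalgebra_isAlgebra.Build R Q quot_scalerAr.

Fact quot_pi_is_monoid_morphism : monoid_morphism quot_pi.
Proof. by split=> // x y; rewrite quot_piM. Qed.
HB.instance Definition _ := GRing.isMonoidMorphism.Build A Q quot_pi
  quot_pi_is_monoid_morphism.

Fact quot_pi_is_scalable : scalable quot_pi.
Proof. by move=> c x; rewrite quot_piZ. Qed.
HB.instance Definition _ := GRing.isScalable.Build R A Q *:%R quot_pi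
  quot_pi_is_scalable.

End QuotientAlgebra.

Lemma ideal_gen_ker (R : comNzRingType) (A : algType R) (rel : set A)
    (B : nzRingType) (f : {rmorphism A -> B}) :
  (forall r, rel r -> f r = 0) -> forall x, ideal_gen rel x -> f x = 0.
Proof.
move=> frel x; elim=> [|a r b y rr _ IH]; first exact: rmorph0.
by rewrite rmorphD !rmorphM (frel r rr) mulr0 mul0r IH addr0.
Qed.

Lemma ideal_gen_proper (R : comNzRingType) (A : algType R) (rel : set A)
    (B : nzRingType) (f : {rmorphism A -> B}) :
  (forall r, rel r -> f r = 0) -> ~ ideal_gen rel 1.
Proof.
by move=> frel /(ideal_gen_ker frel)/eqP; rewrite rmorph1 oner_eq0.
Qed.

Section BaseChange.
Variables (R S : comNzRingType) (phi : {rmorphism R -> S}) (A : algType R).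

(* The S-algebra S (x)_R A is generated by the symbols 1 (x) a for a in A,
   subject to the relations saying that a |-> 1 (x) a is a ring homomorphism
   which is semilinear along phi: s (x) a is the scalar multiple of 1 (x) a
   by s. *)
Variant base_change_rel : free_alg S A -> Prop :=
| BaseChange1 : base_change_rel (free_gen S 1 - 1)
| BaseChangeM a b :
    base_change_rel (free_gen S (a * b) - free_gen S a * free_gen S b)
| BaseChangeD a b :
    base_change_rel (free_gen S (a + b) - (free_gen S a + free_gen S b))
| BaseChangeZ c a :
    base_change_rel (free_gen S (c *: a) - phi c *: free_gen S a).

Lemma base_change_proper (f : {rmorphism A -> S}) :
  (forall c a, f (c *: a) = phi c * f a) -> ~ ideal_gen base_change_rel 1.
Proof.
move=> fZ; pose h (m : {fmonom A}) := \prod_(a <- (m : seq A)) f a.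
have hM : {morph h : m n / mmul m n >-> m * n} * (h mone = 1).
  by split=> [m n|]; rewrite /h ?fm1 ?big_nil // fmM big_cat.
pose hm : {mmorphism {fmonom A} -> S} :=
  HB.pack h (isMultiplicative.Build _ _ h hM).
pose F : {rmorphism {malg S[{fmonom A}]} -> S} := mmap (idfun : S -> S) hm.
have FU (a : A) : F << fmu a >> = f a.
  by rewrite /F /= mmapU mul1r /= /h fmU big_seq1.
have FZ (c : S) (x : {malg S[{fmonom A}]}) : F (c *: x) = c * F x.
  exact: (@mmapZ _ S S idfun hm c x).
have Frel r : base_change_rel r -> F r = 0.
  case=> [|a b|a b|c a]; apply/eqP; rewrite -[free_gen S _]/(<< fmu _ >>).
  - by rewrite rmorphB subr_eq0 FU !rmorph1.
  - by rewrite rmorphB subr_eq0 rmorphM !FU rmorphM.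
  - by rewrite rmorphB subr_eq0 rmorphD !FU rmorphD.
  - by rewrite rmorphB subr_eq0 FZ !FU fZ.
suff F0 x : ideal_gen base_change_rel x -> F x = 0.
  by move/F0/eqP; rewrite rmorph1 oner_eq0.
elim=> [|a r b y rr _ IH]; first exact: rmorph0.
by rewrite rmorphD !rmorphM (Frel r rr) mulr0 mul0r IH addr0.
Qed.

End BaseChange.

Record quiver := Quiver {
  vertex : finType;
  arrow : finType;
  src : arrow -> vertex;
  tgt : arrow -> vertex }.
Arguments src {q} _.
Arguments tgt {q} _.

(* In a cyclic list of arrows every target is the next source; a loop is a
   cyclic list of length 1. *)
Definition acyclic (Q : quiver) : Prop :=
  forall p : seq (arrow Q), cycle [rel a b | tgt a == src b] p -> p = [::].

Definition narrows (Q : quiver) (i j : vertex Q) : nat :=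
  #|[pred a : arrow Q | (src a == i) && (tgt a == j)]|.

Definition dimv (Q : quiver) := {ffun vertex Q -> nat}.
HB.instance Definition _ (Q : quiver) := GRing.Nmodule.on (dimv Q).

Definition sigma (Q : quiver) (i : vertex Q) : dimv Q :=
  [ffun j => nat_of_bool (j == i)].

Section Representations.
Variables (k : closedFieldType) (Q : quiver).
Implicit Types c d e : dimv Q.

(* As usual in MathComp, linear maps act on row vectors by right
   multiplication: the arrow a is sent to the map u |-> u *m X a. *)
Definition rep d := forall a : arrow Q, 'M[k]_(d (src a), d (tgt a)).

Definition rep_hom d e (M : rep d) (N : rep e)
    (f : forall i, 'M[k]_(d i, e i)) : Prop :=
  forall a, M a *m f (tgt a) = f (src a) *m N a.

(* 0 -> N -> X -> M -> 0 *)
Definition short_exact d c e (N : rep e) (X : rep c) (M : rep d) : Prop :=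
  exists f g, [/\ rep_hom N X f, rep_hom X M g &
    forall i, [/\ row_free (f i), row_full (g i) & (f i == kermx (g i))%MS]].

Definition extensions d e (A : set (rep d)) (B : set (rep e)) c :
    set (rep c) :=
  [set X | exists M N, [/\ A M, B N & short_exact N X M]].

(* With row vectors, g gives an isomorphism from X to this representation. *)
Definition base_change_act d (g : forall i, 'M[k]_(d i)) (X : rep d) : rep d :=
  fun a => invmx (g (src a)) *m X a *m g (tgt a).

Definition stable d (A : set (rep d)) : Prop :=
  forall g X, (forall i, g i \in unitmx) -> A X -> A (base_change_act g X).

Definition coord d := {a : arrow Q & ('I_(d (src a)) * 'I_(d (tgt a)))%type}.

Definition coords d (X : rep d) (n : 'I_#|{: coord d}|) : k :=
  let x := enum_val n in X (tag x) (tagged x).1 (tagged x).2.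

Definition zariski_closed d (A : set (rep d)) : Prop :=
  exists F : set (mpoly.mpoly #|{: coord d}| k),
    A = [set X | forall p, F p -> mpoly.meval (coords X) p = 0].

Definition irreducible d (A : set (rep d)) : Prop :=
  A !=set0 /\
  forall Z1 Z2, zariski_closed Z1 -> zariski_closed Z2 ->
    A `<=` Z1 `|` Z2 -> A `<=` Z1 \/ A `<=` Z2.

Lemma exactP (n m p : nat) (f : 'M[k]_(n, m)) (g : 'M[k]_(m, p)) :
  [/\ row_free f, row_full g & (f == kermx g)%MS] <->
  [/\ row_free f, row_full g, f *m g = 0 & m = (p + n)%N].
Proof.
split=> [[ff gf /andP[fk kf]]|[ff gf fg0 mE]].
  have /sub_kermxP fg0 := fk; split=> //.
  have /eqP rf := ff; have /eqP rg := gf.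
  have := mxrank_ker g; rewrite rg.
  have -> : \rank (kermx g) = n.
    by rewrite -rf; apply/eqP; rewrite eqn_leq !mxrankS.
  by move=> ->; rewrite subnKC // -rg rank_leq_row.
split=> //; have /sub_kermxP fk := fg0.
have [_ <-] := mxrank_leqif_eq fk; have /eqP -> := ff.
by have /eqP rg := gf; rewrite mxrank_ker rg mE addKn.
Qed.

Lemma row_full_factor (n m p q : nat) (f : 'M[k]_(n, m)) (g : 'M[k]_(m, p))
    (h : 'M[k]_(m, q)) :
  row_full g -> (f == kermx g)%MS -> f *m h = 0 -> g *m (pinvmx g *m h) = h.
Proof.
move=> gf /andP[_ kf] fh0; apply/eqP; rewrite -subr_eq0 mulmxA.
rewrite -[X in _ - X]mul1mx -mulmxBl.
have : (g *m pinvmx g - 1%:M <= f)%MS.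
  apply: submx_trans kf; apply/sub_kermxP.
  by rewrite mulmxBl mul1mx -mulmxA mulVpmx // mulmx1 subrr.
by case/submxP=> D ->; rewrite -mulmxA fh0 mulmx0.
Qed.

Lemma row_full_left_inj (m p q : nat) (g : 'M[k]_(m, p)) (u v : 'M[k]_(p, q)) :
  row_full g -> g *m u = g *m v -> u = v.
Proof.
by move=> gf E; rewrite -[u]mul1mx -[v]mul1mx -(mulVpmx gf) -!mulmxA E.
Qed.

Lemma row_free_right_inj (m p q : nat) (f : 'M[k]_(m, p)) (u v : 'M[k]_(q, m)) :
  row_free f -> u *m f = v *m f -> u = v.
Proof. by move=> ff E; apply: (row_free_inj ff). Qed.

Lemma coker_exists (n m p : nat) (h : 'M[k]_(n, m)) :
  row_free h -> m = (p + n)%N ->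
  exists q : 'M[k]_(m, p), row_full q /\ (h == kermx q)%MS.
Proof.
move=> hf mE; have /eqP rh := hf.
have rC : \rank (cokermx h) = p by rewrite mxrank_coker rh mE addnK.
case: p / rC mE => mE; exists (col_base (cokermx h)).
have qf : row_full (col_base (cokermx h)) by exact: col_base_full.
split=> //; have /exactP [] // : [/\ row_free h,
  row_full (col_base (cokermx h)), h *m col_base (cokermx h) = 0
  & m = (\rank (cokermx h) + n)%N].
split=> //; apply: (row_free_right_inj (row_base_free (cokermx h))).
by rewrite mul0mx -mulmxA mulmx_base mulmx_coker.
Qed.

Lemma ker_exists (m n p : nat) (t : 'M[k]_(m, p)) :
  row_full t -> m = (p + n)%N ->
  exists f : 'M[k]_(n, m), row_free f /\ (f == kermx t)%MS.
Proof.
move=> tf mE; have /eqP rt := tf.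
have rK : \rank (kermx t) = n by rewrite mxrank_ker rt mE addKn.
case: n / rK mE => mE; exists (row_base (kermx t)).
by split; [exact: row_base_free | apply/eqmxP/eq_row_base].
Qed.

Lemma short_exact_dim d c e (N : rep e) (X : rep c) (M : rep d) :
  short_exact N X M -> c = d + e.
Proof.
by case=> f [g [_ _ ex]]; apply/ffunP=> i; rewrite !ffunE;
   have [_ _ _ ->] := (exactP _ _).1 (ex i).
Qed.

Lemma coker_rep c e (p : dimv Q) (N : rep e) (X : rep c)
    (h : forall i, 'M[k]_(e i, c i)) (q : forall i, 'M[k]_(c i, p i)) :
  rep_hom N X h -> (forall i, row_full (q i) /\ (h i == kermx (q i))%MS) ->
  exists Z : rep p, rep_hom X Z q.
Proof.
move=> hh qE; exists (fun a => pinvmx (q (src a)) *m (X a *m q (tgt a))) => a.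
have [qf kq] := qE (src a); rewrite (row_full_factor qf kq) //.
have [_ /andP[/sub_kermxP hq0 _]] := qE (tgt a).
by rewrite mulmxA -hh -mulmxA hq0 mulmx0.
Qed.

Lemma ker_rep c (p m : dimv Q) (X : rep c) (M : rep p)
    (f : forall i, 'M[k]_(m i, c i)) (t : forall i, 'M[k]_(c i, p i)) :
  rep_hom X M t -> (forall i, row_free (f i) /\ (f i == kermx (t i))%MS) ->
  exists Y : rep m, rep_hom Y X f.
Proof.
move=> th fE; exists (fun a => f (src a) *m X a *m pinvmx (f (tgt a))) => a.
rewrite mulmxKpV //; have [_ /andP[_ kf]] := fE (tgt a).
apply: submx_trans kf; apply/sub_kermxP.
have [_ /andP[/sub_kermxP ft0 _]] := fE (src a).
by rewrite -mulmxA th mulmxA ft0 mul0mx.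
Qed.

Lemma extensionsA d1 d2 d3 (A : set (rep d1)) (B : set (rep d2))
    (C : set (rep d3)) c :
  extensions A (extensions B C (c := d2 + d3)) (c := c) =
  extensions (extensions A B (c := d1 + d2)) C (c := c).
Proof.
apply/seteqP; split=> X.
  case=> M [Y [AM [P [N [BP CN]]]]].
  case=> fN [gP [fNh gPh exY]] [fY [gX [fYh gXh exX]]].
  have cE i : c i = ((d1 + d2)%R i + d3 i)%N.
    have [_ _ _ ->] := (exactP _ _).1 (exX i).
    by rewrite !ffunE addnA.
  pose h i := fN i *m fY i.
  have hf i : row_free (h i).
    apply/row_freeP; have [/row_freeP[a aE] _ _] := exY i.
    have [/row_freeP[b bE] _ _] := exX i.
    by exists (b *m a); rewrite mulmxA -[h i *m b]mulmxA bE mulmx1 aE.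
  have hh : rep_hom N X h by move=> a; rewrite mulmxA fNh -mulmxA fYh mulmxA.
  pose q i := sval (cid (coker_exists (hf i) (cE i))).
  have qE i : row_full (q i) /\ (h i == kermx (q i))%MS.
    exact: svalP (cid (coker_exists (hf i) (cE i))).
  have [Z qh] := coker_rep hh qE.
  have hq0 i : h i *m q i = 0 by have [_ /andP[/sub_kermxP]] := qE i.
  pose p i := pinvmx (gP i) *m (fY i *m q i).
  have pE i : gP i *m p i = fY i *m q i.
    have [_ gPf kP] := exY i; apply: row_full_factor gPf kP _.
    by rewrite mulmxA hq0.
  pose r i := pinvmx (q i) *m gX i.
  have rE i : q i *m r i = gX i.
    have [qf kq] := qE i; apply: row_full_factor qf kq _.
    by have [_ _ /andP[/sub_kermxP fg0 _]] := exX i; rewrite -mulmxA fg0 mulmx0.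
  clearbody p r.
  have ph : rep_hom P Z p.
    move=> a; have [_ gPf _] := exY (src a); apply: (row_full_left_inj gPf).
    by rewrite mulmxA -gPh -mulmxA pE !mulmxA pE fYh -!mulmxA qh.
  have rh : rep_hom Z M r.
    move=> a; have [qf _] := qE (src a); apply: (row_full_left_inj qf).
    by rewrite mulmxA -qh -mulmxA rE mulmxA rE gXh.
  exists Z, N; split=> //; last first.
    by exists h, q; split=> // i; have [] := qE i.
  exists M, P; split=> //; exists p, r; split=> // i; apply/exactP.
  have [fNf gPf kP] := exY i; have [fYf gXf kX] := exX i; have [qf kq] := qE i.
  split; last by rewrite ffunE.
  - apply: inj_row_free => v vp0.
    pose w := v *m pinvmx (gP i).
    have wE : w *m gP i = v by rewrite mulmxKpV // submx_full.
    have : (w *m fY i <= h i)%MS.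
      case/andP: kq => _ kq; apply: submx_trans kq; apply/sub_kermxP.
      by rewrite -mulmxA -pE mulmxA wE.
    case/submxP=> D; rewrite mulmxA => /(row_free_right_inj fYf) wD.
    have /andP[/sub_kermxP fgP0 _] := kP.
    by rewrite -wE wD -mulmxA fgP0 mulmx0.
  - apply/row_fullP; have /row_fullP[b bE] := gXf.
    by exists (b *m q i); rewrite -mulmxA rE.
  - apply: (row_full_left_inj gPf).
    have /andP[/sub_kermxP fgX0 _] := kX.
    by rewrite mulmxA pE -mulmxA rE fgX0 mulmx0.
case=> Z [N [[M [P [AM BP [p [r [ph rh exZ]]]]]] CN [h [q [hh qh exX]]]]].
have cE i : c i = (d1 i + (d2 + d3)%R i)%N.
  have [_ _ _ ->] := (exactP _ _).1 (exX i).
  by rewrite !ffunE addnA.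
pose t i := q i *m r i.
have tf i : row_full (t i).
  apply/row_fullP; have [_ /row_fullP[a aE] _] := exZ i.
  have [_ /row_fullP[b bE] _] := exX i.
  by exists (a *m b); rewrite mulmxA -[a *m b *m _]mulmxA bE mulmx1 aE.
have th : rep_hom X M t by move=> a; rewrite mulmxA qh -mulmxA rh mulmxA.
pose fY i := sval (cid (ker_exists (tf i) (cE i))).
have fYE i : row_free (fY i) /\ (fY i == kermx (t i))%MS.
  exact: svalP (cid (ker_exists (tf i) (cE i))).
have [Y fYh] := ker_rep th fYE.
have ft0 i : fY i *m t i = 0 by have [_ /andP[/sub_kermxP]] := fYE i.
have lift i m (v : 'M_(m, _)) :
    v *m t i = 0 -> v *m pinvmx (fY i) *m fY i = v.
  move=> vt0; rewrite mulmxKpV //; have [_ /andP[_]] := fYE i.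
  by apply: submx_trans; apply/sub_kermxP.
pose fN i := h i *m pinvmx (fY i).
have fNE i : fN i *m fY i = h i.
  apply: lift; have [_ _ /andP[/sub_kermxP hq0 _]] := exX i.
  by rewrite mulmxA hq0 mul0mx.
pose gP i := fY i *m q i *m pinvmx (p i).
have gPE i : gP i *m p i = fY i *m q i.
  rewrite mulmxKpV //; have [_ _ /andP[_ kp]] := exZ i.
  by apply: submx_trans kp; apply/sub_kermxP; rewrite -mulmxA ft0.
clearbody fN gP.
have fNh : rep_hom N Y fN.
  move=> a; have [fYf _] := fYE (tgt a); apply: (row_free_right_inj fYf).
  by rewrite -mulmxA fNE hh -(fNE (src a)) -!mulmxA fYh.
have gPh : rep_hom Y P gP.
  move=> a; have [pf _ _] := exZ (tgt a); apply: (row_free_right_inj pf).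
  by rewrite -mulmxA gPE mulmxA fYh -mulmxA qh mulmxA -gPE -!mulmxA ph.
exists M, Y; split=> //; last first.
  by exists fY, t; split=> // i; have [] := fYE i.
exists P, N; split=> //; exists fN, gP; split=> // i; apply/exactP.
have [pf rf kr] := exZ i; have [hf qf kq] := exX i; have [fYf _] := fYE i.
split; last by rewrite ffunE.
- have /row_freeP[a aE] := hf; apply/row_freeP.
  by exists (fY i *m a); rewrite mulmxA fNE.
- pose w := p i *m pinvmx (q i).
  have wE : w *m q i = p i by rewrite mulmxKpV // submx_full.
  apply/row_fullP; exists (w *m pinvmx (fY i)).
  apply: (row_free_right_inj pf); rewrite -mulmxA gPE mul1mx.
  rewrite mulmxA lift // mulmxA wE.
  by have /andP[/sub_kermxP] := kr.
- apply: (row_free_right_inj pf).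
  have /andP[/sub_kermxP hq0 _] := kq.
  by rewrite -mulmxA gPE mulmxA fNE hq0 mul0mx.
Qed.

Lemma stable_iso d (A : set (rep d)) (X M : rep d) (g : forall i, 'M[k]_(d i)) :
  stable A -> (forall i, g i \in unitmx) -> rep_hom X M g -> A M -> A X.
Proof.
move=> stA gU gh AM.
have -> : X = base_change_act (fun i => invmx (g i)) M.
  apply: functional_extensionality_dep => a.
  by rewrite /base_change_act invmxK -gh mulmxK.
by apply: stA => // i; rewrite unitmx_inv.
Qed.

Lemma extensions_stable d e c (A : set (rep d)) (B : set (rep e)) :
  stable (extensions A B (c := c)).
Proof.
move=> h X hU [M [N [AM BN [f [g [fh gh ex]]]]]]; exists M, N; split=> //.
exists (fun i => f i *m h i), (fun i => invmx (h i) *m g i); split.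
- by move=> a; rewrite mulmxA fh /base_change_act !mulmxA mulmxK.
- by move=> a; rewrite /base_change_act mulmxA mulmxK // -mulmxA gh mulmxA.
move=> i; apply/exactP.
have [ff gf fg0 E] := (exactP _ _).1 (ex i); split=> //.
- have /row_freeP[b bE] := ff; apply/row_freeP.
  by exists (invmx (h i) *m b); rewrite mulmxA mulmxK.
- have /row_fullP[b bE] := gf; apply/row_fullP.
  by exists (b *m h i); rewrite mulmxA mulmxK.
- by rewrite mulmxA mulmxK.
Qed.

Lemma rep_eq0 d (X Y : rep d) : (forall i, d i = 0)%N -> X = Y.
Proof.
move=> d0; apply: functional_extensionality_dep => a; apply/matrixP=> i.
by have := ltn_ord i; rewrite [X in (_ < X)%N]d0.
Qed.

Lemma extensions1 d (A : set (rep d)) :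
  stable A -> extensions A [set: rep 0] (c := d) = A.
Proof.
move=> stA; apply/seteqP; split=> X.
  case=> M [N [AM _ [f [g [_ gh ex]]]]]; apply: stable_iso stA _ gh AM => i.
  by have [_ gf _ _] := (exactP _ _).1 (ex i); rewrite -row_full_unit.
move=> AX; exists X, (fun a => 0); split=> //.
exists (fun i => 0), (fun i => 1%:M); split=> [a|a|i].
- by rewrite mulmx0 mul0mx.
- by rewrite mulmx1 mul1mx.
apply/exactP; split; rewrite ?ffunE ?addn0 ?row_full_unit ?unitmx1 ?mul0mx //.
by rewrite /row_free mxrank0.
Qed.

Lemma extensions1l d (A : set (rep d)) :
  stable A -> extensions [set: rep 0] A (c := d) = A.
Proof.
move=> stA; apply/seteqP; split=> X.
  case=> M [N [_ AN [f [g [fh _ ex]]]]].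
  have fU i : f i \in unitmx.
    by have [ff _ _ _] := (exactP _ _).1 (ex i); rewrite -row_free_unit.
  apply: (@stable_iso _ _ _ N (fun i => invmx (f i))) stA _ _ AN.
    by move=> i; rewrite unitmx_inv.
  move=> a; apply: (row_free_right_inj (f := f (tgt a))).
    by rewrite row_free_unit.
  by rewrite mulmxKV // -mulmxA fh mulKmx.
move=> AX; exists (fun a => 0), X; split=> //.
exists (fun i => 1%:M), (fun i => 0); split=> [a|a|i].
- by rewrite mulmx1 mul1mx.
- by rewrite mulmx0 mul0mx.
apply/exactP; split; rewrite ?ffunE ?row_free_unit ?unitmx1 ?mulmx0 //.
by rewrite /row_full mxrank0.
Qed.

(* All the G_d-stable subsets of the R_d form a monoid under *, with unit R_0;
   the extension monoid M(Q) consists of the irreducible closed ones. *)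
Definition stable_set :=
  {A : {d : dimv Q & set (rep d)} | `[< stable (tagged A) >]}.
HB.instance Definition _ := Choice.on stable_set.

Definition StableSet d (A : set (rep d)) (stA : stable A) : stable_set :=
  exist _ (Tagged (fun d => set (rep d)) A) (asboolT stA).

Definition dim_of (A : stable_set) : dimv Q := tag (val A).
Definition set_of (A : stable_set) : set (rep (dim_of A)) := tagged (val A).
Arguments set_of : clear implicits.

Lemma set_of_stable A : stable (set_of A).
Proof. exact/asboolP/(valP A). Qed.

Lemma setT_stable d : stable [set: rep d].
Proof. by []. Qed.

Definition full d : stable_set := StableSet (@setT_stable d).

Definition ext_mul (A B : stable_set) : stable_set :=
  StableSet (@extensions_stable _ _ (dim_of A + dim_of B) (set_of A) (set_of B)).

Lemma stable_set_eq (P : forall d, set (rep d)) d (stP : stable (P d))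
    (A : stable_set) :
  d = dim_of A -> P (dim_of A) = set_of A -> StableSet stP = A.
Proof.
case: A => -[e A] stA /= de; move: stP; rewrite /dim_of /set_of /= in de *.
by case: e / de A stA => A stA stP PA; apply: val_inj; rewrite /= PA.
Qed.

Lemma ext_mulA : associative ext_mul.
Proof.
move=> A B C; apply: (stable_set_eq
  (P := fun c => extensions (set_of A) (set_of (ext_mul B C)) (c := c))).
  by rewrite /dim_of /= addrA.
exact: extensionsA.
Qed.

Lemma ext_mul1l : left_id (full 0) ext_mul.
Proof.
move=> A; apply: (stable_set_eq
  (P := fun c => extensions (set_of (full 0)) (set_of A) (c := c))).
  by rewrite /dim_of /= add0r.
exact: extensions1l (@set_of_stable A).
Qed.

Lemma ext_mul1r : right_id (full 0) ext_mul.
Proof.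
move=> A; apply: (stable_set_eq
  (P := fun c => extensions (set_of A) (set_of (full 0)) (c := c))).
  by rewrite /dim_of /= addr0.
exact: extensions1 (@set_of_stable A).
Qed.

Lemma eq_full0 (A : stable_set) :
  (forall i, dim_of A i = 0)%N -> set_of A !=set0 -> A = full 0.
Proof.
move=> d0 [X AX]; apply/esym/(stable_set_eq (P := fun d => [set: rep d])).
  by apply/ffunP=> i; rewrite d0 ffunE.
by apply/seteqP; split=> // Y _; rewrite (rep_eq0 Y X d0).
Qed.

Lemma ext_mul_eq1 A B : ext_mul A B = full 0 -> A = full 0 /\ B = full 0.
Proof.
move=> AB1; have d0 i : (dim_of A i + dim_of B i = 0)%N.
  have : dim_of (ext_mul A B) i = 0%N by rewrite AB1 ffunE.
  by rewrite ffunE.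
have : set_of (ext_mul A B) !=set0 by rewrite AB1; exists (fun a => 0).
case=> X [M [N [AM BN _]]].
split; apply: eq_full0; try by [exists M | exists N].
  by move=> i; have /eqP := d0 i; rewrite addn_eq0 => /andP[/eqP].
by move=> i; have /eqP := d0 i; rewrite addn_eq0 => /andP[_ /eqP].
Qed.

HB.instance Definition _ := Choice_isMonomialDef.Build stable_set
  ext_mulA ext_mul1l ext_mul1r ext_mul_eq1.

Definition extension_monoid : set stable_set :=
  [set A | irreducible (set_of A) /\ zariski_closed (set_of A)].

Definition submonoid (S : set stable_set) : Prop :=
  S mone /\ forall A B, S A -> S B -> S (mmul A B).

(* The submonoid of M(Q) generated by the R_(sigma_i), as an intersection of
   submonoids. *)
Definition composition_set : set stable_set :=
  [set A | forall S, S `<=` extension_monoid -> submonoid S ->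
     (forall i, S (full (sigma i))) -> S A].

Definition composition_monoid := {A : stable_set | `[< composition_set A >]}.
HB.instance Definition _ := Choice.on composition_monoid.

End Representations.

Section CompositionMonoid.
Variables (k : closedFieldType) (Q : quiver).
Implicit Types A B : composition_monoid k Q.

Lemma composition_set1 : @composition_set k Q mone.
Proof. by move=> S _ [S1 _] _. Qed.

Lemma composition_setM (A B : stable_set k Q) :
  composition_set A -> composition_set B -> composition_set (mmul A B).
Proof.
by move=> cA cB S SM subS Ssigma; apply: subS.2; [apply: cA | apply: cB].
Qed.

Lemma composition_set_sigma i : composition_set (@full k Q (sigma i)).
Proof. by move=> S _ _; apply. Qed.

Definition comp_one : composition_monoid k Q :=
  exist _ mone (asboolT composition_set1).

Definition comp_mul A B : composition_monoid k Q :=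
  exist _ (mmul (val A) (val B))
    (asboolT (composition_setM (asboolW (valP A)) (asboolW (valP B)))).

Definition comp_gen (i : vertex Q) : composition_monoid k Q :=
  exist _ (full k (sigma i)) (asboolT (@composition_set_sigma i)).

Lemma comp_mulA : associative comp_mul.
Proof. by move=> A B C; apply: val_inj; apply: mulmA. Qed.

Lemma comp_mul1l : left_id comp_one comp_mul.
Proof. by move=> A; apply: val_inj; apply: mul1m. Qed.

Lemma comp_mul1r : right_id comp_one comp_mul.
Proof. by move=> A; apply: val_inj; apply: mulm1. Qed.

Lemma comp_mul_eq1 A B : comp_mul A B = comp_one -> A = comp_one /\ B = comp_one.
Proof. by case/(congr1 val)/unitm => A1 B1; split; apply: val_inj. Qed.

HB.instance Definition _ := Choice_isMonomialDef.Build (composition_monoid k Q)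
  comp_mulA comp_mul1l comp_mul1r comp_mul_eq1.

End CompositionMonoid.

Definition qfact (M : nat) : {poly rat} := \prod_(1 <= m < M.+1) ('X^m - 1).

(* The division in Q[q] is exact, with quotient in Z[q]. *)
Definition qbinom (M N : nat) : {poly rat} :=
  qfact (M + N) %/ (qfact M * qfact N).

Section QuantumGroup.
Variable Q : quiver.
Local Notation F := (free_alg {poly rat} (vertex Q)).
Local Notation E i := (free_gen {poly rat} i).

(* Here p ranges over 0, ..., n + 1 and p' = n + 1 - p. *)
Definition serre_l (i j : vertex Q) : F :=
  let n := narrows i j in
  \sum_(p < n.+2) let p' := (n.+1 - p)%N in
    ((-1) ^+ p' * 'X^(p' * (p' - 1)) * qbinom p p') *:
      (E i ^+ p * E j * E i ^+ p').

Definition serre_r (i j : vertex Q) : F :=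
  let n := narrows i j in
  \sum_(p < n.+2) let p' := (n.+1 - p)%N in
    ((-1) ^+ p * 'X^(p * (p - 1)) * qbinom p p') *:
      (E j ^+ p * E i * E j ^+ p').

Variant serre_rel : F -> Prop :=
| SerreL i j : narrows j i = 0%N -> serre_rel (serre_l i j)
| SerreR i j : narrows j i = 0%N -> serre_rel (serre_r i j).

Definition counit (x : F) : {poly rat} :=
  @mcoeff {fmonom vertex Q} {poly rat} mone x.
HB.instance Definition _ := GRing.isZmodMorphism.Build F {poly rat} counit
  (fun x y => mcoeffB mone x y).
HB.instance Definition _ := GRing.isMonoidMorphism.Build F {poly rat} counit
  (rmorph1 (@mcoeff {fmonom vertex Q} {poly rat} mone),
   fun x y => rmorphM (@mcoeff {fmonom vertex Q} {poly rat} mone) x y).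

Lemma counitZ c x : counit (c *: x) = c * counit x.
Proof. exact: mcoeffZ. Qed.

Lemma counit_gen i : counit (E i) = 0.
Proof. by rewrite /counit mcoeffU1 fm1_eq1. Qed.

Lemma counit_serre r : serre_rel r -> counit r = 0.
Proof.
by case=> i j _; rewrite rmorph_sum big1 //= => p _; rewrite counitZ !rmorphM /=;
   rewrite counit_gen mulr0 mul0r mulr0.
Qed.

Definition serre_proper := ideal_gen_proper (f := counit) counit_serre.

Definition Uplus := quot_alg serre_proper.

Definition Uplus_gen (i : vertex Q) : Uplus := quot_pi serre_proper (E i).

Definition Uplus_counit (u : Uplus) : {poly rat} := counit (repr u).

Lemma Uplus_counit_pi x : Uplus_counit (quot_pi serre_proper x) = counit x.
Proof.
apply/eqP; rewrite -subr_eq0 -rmorphB; apply/eqP.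
apply: (ideal_gen_ker counit_serre).
by apply/(quot_piP serre_proper); rewrite quot_piK.
Qed.

Definition Uplus_counit0 (u : Uplus) : rat := (Uplus_counit u).[0].

Fact Uplus_counit0_is_zmod_morphism : zmod_morphism Uplus_counit0.
Proof.
move=> u v; rewrite -(quot_piK u) -(quot_piK v) -raddfB /Uplus_counit0.
by rewrite !Uplus_counit_pi rmorphB hornerD hornerN.
Qed.
HB.instance Definition _ := GRing.isZmodMorphism.Build Uplus rat Uplus_counit0
  Uplus_counit0_is_zmod_morphism.

Fact Uplus_counit0_is_monoid_morphism : monoid_morphism Uplus_counit0.
Proof.
rewrite /Uplus_counit0; split=> [|u v].
  by rewrite -[1](rmorph1 (quot_pi serre_proper)) Uplus_counit_pi rmorph1 hornerC.
rewrite -(quot_piK u) -(quot_piK v) -rmorphM.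
by rewrite !Uplus_counit_pi rmorphM hornerM.
Qed.
HB.instance Definition _ := GRing.isMonoidMorphism.Build Uplus rat Uplus_counit0
  Uplus_counit0_is_monoid_morphism.

Fact Uplus_counit0Z (c : {poly rat}) (u : Uplus) :
  Uplus_counit0 (c *: u) = horner_eval 0 c * Uplus_counit0 u.
Proof.
rewrite -(quot_piK u) -linearZ /Uplus_counit0 !Uplus_counit_pi.
by rewrite counitZ hornerM.
Qed.

Definition U0plus_proper := base_change_proper (phi := horner_eval 0)
  (f := Uplus_counit0) Uplus_counit0Z.

(* Q (x)_{Q[q]} U^+(Q), where q acts on Q as 0 *)
Definition U0plus := quot_alg U0plus_proper.

(* 1 (x) E_i *)
Definition U0plus_gen (i : vertex Q) : U0plus :=
  quot_pi U0plus_proper (free_gen rat (Uplus_gen i)).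

End QuantumGroup.

(* Main.v *)
Require Import Defs.
From HB Require Import structures.
From mathcomp Require Import all_boot all_order all_algebra.
From mathcomp Require Import perm boolp classical_sets.
From mathcomp Require Import ring.
From mathcomp Require Import mpoly monalg.
Import Defs GRing.Theory.
Local Open Scope ring_scope.
Local Open Scope classical_set_scope.

Set Implicit Arguments.
Unset Strict Implicit.
Unset Printing Implicit Defensive.

(** The composition monoid consists of the products of the R_(sigma_i), which
    are called words below.  Two facts about words carry the proof.

    First, every word lies in the extension monoid, that is, the product of
    simple representation spaces is irreducible and closed
    ([word_extension]).  This is needed because the composition monoid is an
    intersection over the submonoids of the extension monoid containing the
    R_(sigma_i): only once the words are known to form such a submonoid do
    they exhaust the intersection, and surjectivity of eta depends on it.

    Irreducibility of A * R_e ([extensions_irreducible]): up to base change h,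
    an extension X is block triangular with a block M in A and an arbitrary
    block Y in a linear space, so A * R_e is the image of a product of A with
    an open subset of an affine space, and two points with the same M are
    joined by a rational curve (h_t, Y_t).

    Closedness of A * R_(sigma_i) ([extensions_simple_closed]): X belongs to it
    when some line in X_i is a subrepresentation with quotient in A.  The lines
    form a projective space, and what is needed is that projecting along it
    preserves closed sets.  The lines contained in the span of the basis
    vectors e_0, ..., e_j are treated by induction on j: for j = 0 there is a
    single line and closed conditions on X, and passing from j to j + 1 moves
    the set by a family of base changes parametrized by a projective line.  So
    only completeness of the projective line is used ([sweep_closed]), which is
    elimination of one variable by a resultant.

    Second, at q = 0 the coefficients with at least two powers of E_i on the
    right (resp. of E_j on the left) vanish and the Gaussian binomials have
    value 1, so the relations become
      E_i^(n+1) E_j = E_i^n E_j E_i   and   E_i E_j^(n+1) = E_j E_i E_j^n,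
    with n the number of arrows from i to j.  The corresponding identities
    between words hold because both sides are the whole representation space
    ([serre_word_l], [serre_word_r]): n linear forms on a space of dimension
    n + 1 have a common nonzero zero, which spans a simple subrepresentation,
    and dually.

    The rest is formal.  The homomorphism is obtained from the universal
    properties of the free algebra ([free_alg_eval]) and of the quotient
    ([quot_lift]), each used twice; it is determined by the images of the E_i
    because these generate ([U0plus_ind]). *)

(** * Rings of functions and Zariski closed sets *)

Lemma mem_eq1 (T U : Type) (S : set (T -> U)) (f g : T -> U) :
  f =1 g -> S g -> S f.
Proof. by move/funext=> ->. Qed.

(** The right-hand side need not be written out: it is found by the rewriting
    at a generic argument. *)
Ltac under_mem l :=
  apply: mem_eq1 => [?|]; first (rewrite l; reflexivity).

Section FunctionRings.
Variables (k : comNzRingType) (T : Type) (S : set (T -> k)).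

(** Three kinds of functions occur: regular functions on the representation
    space, the same with an additional polynomial parameter, and fractions in
    one variable.  All that is ever used of each is closure under polynomial
    expressions. *)
Definition function_ring : Prop :=
  [/\ forall c, S (fun=> c),
      forall f g, S f -> S g -> S (fun x => f x + g x)
    & forall f g, S f -> S g -> S (fun x => f x * g x)].

Hypothesis ringS : function_ring.

Lemma function_ring_sum (J : Type) (r : seq J) (P : pred J) (f : J -> T -> k) :
  (forall j, P j -> S (f j)) -> S (fun x => \sum_(j <- r | P j) f j x).
Proof.
case: ringS => SC SD _ fS; elim: r => [|j r IH].
  by under_mem big_nil; exact: SC.
under_mem big_cons.
case Pj: (P j) => //.
by apply: SD => //; exact: fS.
Qed.

Lemma function_ring_prod (J : Type) (r : seq J) (P : pred J) (f : J -> T -> k) :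
  (forall j, P j -> S (f j)) -> S (fun x => \prod_(j <- r | P j) f j x).
Proof.
case: ringS => SC _ SM fS; elim: r => [|j r IH].
  by under_mem big_nil; exact: SC.
under_mem big_cons.
case Pj: (P j) => //.
by apply: SM => //; exact: fS.
Qed.

Lemma function_ring_opp f : S f -> S (fun x => - f x).
Proof.
case: ringS => SC _ SM fS; have := SM _ _ (SC (-1)) fS; apply: mem_eq1 => x.
by rewrite mulN1r.
Qed.

Lemma function_ring_meval n (p : mpoly n k) (v : T -> 'I_n -> k) :
  (forall i, S (fun x => v x i)) -> S (fun x => meval (v x) p).
Proof.
case: ringS => SC _ SM vS; under_mem mevalE.
apply: function_ring_sum => m _; apply: (SM); first exact: SC.
apply: function_ring_prod => i _; elim: (m i : nat) => [|e IH].
  by under_mem expr0; exact: SC.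
under_mem exprS.
exact: SM.
Qed.

Definition matrix_over m n (F : T -> 'M[k]_(m, n)) : Prop :=
  forall i j, S (fun x => F x i j).

Lemma matrix_over_const m n (A : 'M[k]_(m, n)) : matrix_over (fun=> A).
Proof. by case: ringS => SC _ _ i j; exact: SC. Qed.

Lemma matrix_overD m n (F G : T -> 'M[k]_(m, n)) :
  matrix_over F -> matrix_over G -> matrix_over (fun x => F x + G x).
Proof.
case: ringS => _ SD _ FS GS i j; under_mem mxE.
exact: SD.
Qed.

Lemma matrix_overN m n (F : T -> 'M[k]_(m, n)) :
  matrix_over F -> matrix_over (fun x => - F x).
Proof.
move=> FS i j; under_mem mxE.
exact: function_ring_opp.
Qed.

Lemma matrix_overZ m n (f : T -> k) (F : T -> 'M[k]_(m, n)) :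
  S f -> matrix_over F -> matrix_over (fun x => f x *: F x).
Proof.
case: ringS => _ _ SM fS FS i j; under_mem mxE.
exact: SM.
Qed.

Lemma matrix_overM m n p (F : T -> 'M[k]_(m, n)) (G : T -> 'M[k]_(n, p)) :
  matrix_over F -> matrix_over G -> matrix_over (fun x => F x *m G x).
Proof.
case: ringS => _ _ SM FS GS i j; under_mem mxE.
by apply: function_ring_sum => l _; exact: SM.
Qed.

End FunctionRings.

Section RegularFunctions.
Variables (k : closedFieldType) (Q : quiver).
Implicit Types c d e : dimv Q.

Definition regular d : set (rep k d -> k) :=
  [set f | exists p : mpoly #|{: coord d}| k,
             forall X, f X = meval (coords X) p].

Lemma regular_ring d : function_ring (@regular d).
Proof.
split=> [c|f g [p fE] [q gE]|f g [p fE] [q gE]].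
- by exists (mpolyC _ c) => X; rewrite mevalC.
- by exists (p + q) => X; rewrite mevalD fE gE.
- by exists (p * q) => X; rewrite mevalM fE gE.
Qed.

Lemma regular_entry d a : matrix_over (@regular d) (fun X => X a).
Proof.
move=> i j; pose x : coord d := Tagged _ (i, j).
exists (mpolyX _ (mnm1 (enum_rank x))) => X.
by rewrite mevalXU /coords enum_rankK.
Qed.

Lemma regular_subst d (f : rep k d -> k) T (S : set (T -> k))
    (F : T -> rep k d) :
  regular f -> function_ring S -> (forall a, matrix_over S (fun x => F x a)) ->
  S (fun x => f (F x)).
Proof.
case=> p fE ringS FS; under_mem fE.
by apply: function_ring_meval => // n; exact: FS.
Qed.

(** A closed set may be defined by infinitely many equations, so that all
    regular functions vanishing on it can be taken; closedness is then the
    possibility of separating it from each outside point. *)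
Lemma closedP d (A : set (rep k d)) :
  zariski_closed A <->
  forall X, ~ A X ->
    exists f, [/\ regular f, forall Y, A Y -> f Y = 0 & f X != 0].
Proof.
split=> [[F ->] X /= nFX|sep].
  have /existsNP[p /not_implyP[Fp pX]] := nFX.
  exists (fun X => meval (coords X) p); split=> [|Y /= FY|]; last exact/eqP.
    by exists p.
  exact: FY.
exists [set p : mpoly #|{: coord d}| k |
  forall Y, A Y -> meval (coords Y) p = 0].
apply/seteqP; split=> X /=; first by move=> AX p; apply.
apply: contraPP => /sep[f [[p fE] fA /eqP]]; rewrite fE => fX /(_ p) pX.
by apply/fX/pX => Y AY; rewrite -fE fA.
Qed.

Lemma closed_set0 d : zariski_closed (@set0 (rep k d)).
Proof.
apply/closedP=> X _; exists (fun=> 1); split=> //; last exact: oner_neq0.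
by case: (@regular_ring d).
Qed.

Lemma closedI d (A B : set (rep k d)) :
  zariski_closed A -> zariski_closed B -> zariski_closed (A `&` B).
Proof.
move=> /closedP sepA /closedP sepB; apply/closedP=> X /not_andP[/sepA|/sepB];
  by case=> f [fr fv fX]; exists f; split=> // Y [AY BY]; exact: fv.
Qed.

Lemma closed_preimage c d (A : set (rep k d)) (F : rep k c -> rep k d) :
  zariski_closed A -> (forall a, matrix_over (@regular c) (fun X => F X a)) ->
  zariski_closed (F @^-1` A).
Proof.
move=> /closedP sepA Fr; apply/closedP=> X /sepA[f [fr fv fX]].
exists (fun X => f (F X)); split=> // [|Y /fv //].
exact: regular_subst (@regular_ring c) _.
Qed.

Lemma closed_zeros d (J : Type) (f : J -> rep k d -> k) :
  (forall j, regular (f j)) -> zariski_closed [set X | forall j, f j X = 0].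
Proof.
move=> fr; apply/closedP=> X /existsNP[j /eqP fX].
by exists (f j).
Qed.

End RegularFunctions.

(** * Completeness of the projective line *)

(** The Sylvester matrix depends on the degrees; they are unchanged by f as long
    as the leading coefficients survive. *)
Lemma resultant_map (A B : nzRingType) (f : {rmorphism A -> B})
    (p q : {poly A}) :
  f (lead_coef p) != 0 -> f (lead_coef q) != 0 ->
  f (resultant p q) = resultant (map_poly f p) (map_poly f q).
Proof.
move=> fp fq; rewrite /resultant -det_map_mx /Sylvester_mx /=.
rewrite !size_map_poly_id0 // map_col_mx; congr (\det (col_mx _ _));
  apply/matrixP=> i j; rewrite !mxE /= !rVpoly_delta !coefXnM;
  by case: ifP => _; rewrite ?rmorph0 ?coef_map.
Qed.

Section ProjectiveLine.
Variables (k : closedFieldType) (Q : quiver) (d : dimv Q).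

Local Notation coef := (mpoly #|{: coord d}| k).
Local Notation spec X := (map_poly (meval (@coords k Q d X))).

Definition regular_poly : set (rep k d * k -> k) :=
  [set f | exists P : {poly coef}, forall X t, f (X, t) = (spec X P).[t]].

Lemma regular_poly_ring : function_ring regular_poly.
Proof.
split=> [c|f g [p fE] [q gE]|f g [p fE] [q gE]].
- by exists (mpolyC _ c)%:P => X t; rewrite map_polyC hornerC /= mevalC.
- by exists (p + q) => X t; rewrite rmorphD hornerD fE gE.
- by exists (p * q) => X t; rewrite rmorphM hornerM fE gE.
Qed.

Lemma regular_poly_entry a : matrix_over regular_poly (fun x => x.1 a).
Proof.
move=> i j; have [p pE] := @regular_entry k Q d a i j.
by exists p%:P => X t; rewrite map_polyC hornerC /= -pE.
Qed.

Lemma regular_poly_param : regular_poly snd.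
Proof. by exists 'X => X t; rewrite map_polyX hornerX. Qed.

(** The ideal J of k[t] is generated by a nonzero member of least degree, which
    would have a root if it were not constant. *)
Lemma common_root_free (J : {poly k} -> Prop) :
  (forall u v, J u -> J v -> J (u + v)) -> (forall u v, J v -> J (u * v)) ->
  (exists2 u, J u & u != 0) -> (forall t, exists2 u, J u & ~~ root u t) ->
  J 1.
Proof.
move=> JD JM Jnz Jroot.
have [g [Jg gnz gmin]] : exists g, [/\ J g, g != 0 &
    forall u, J u -> u != 0 -> (size g <= size u)%N].
  pose P n := `[< exists u, [/\ J u, u != 0 & size u = n] >].
  have exP : exists n, P n.
    by case: Jnz => u Ju unz; exists (size u); apply/asboolP; exists u.
  case: (ex_minnP exP) => n /asboolP[g [Jg gnz gn]] nmin.
  exists g; split=> // u Ju unz; rewrite gn; apply: nmin.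
  by apply/asboolP; exists u.
have gdvd u : J u -> g %| u.
  move=> Ju; rewrite /dvdp -[_ == 0]negbK; apply/negP=> rnz.
  have Jr : J (u %% g).
    have -> : u %% g = - (u %/ g) * g + u.
      by rewrite {3}(divp_eq u g) mulNr addrA addNr add0r.
    by apply: JD Ju; exact: JM.
  by have := gmin _ Jr rnz; rewrite leqNgt ltn_modp gnz.
have /eqP/size_poly1P[c cnz gE] : size g = 1%N.
  apply/eqP/negPn/negP=> /closed_rootP[t gt].
  have [u /gdvd gu /negP] := Jroot t; apply.
  by rewrite -dvdp_XsubCl (dvdp_trans _ gu) // dvdp_XsubCl.
have -> : 1 = c^-1%:P * g by rewrite gE -polyCM mulVf.
exact: JM.
Qed.

(** The two families are the charts of a family of maps over the projective
    line, glued along t |-> 1/t; the second chart is only needed at its origin.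

    Let X0 be a point outside the union.  A function f vanishing on W but not
    at tau1 0 X0 yields a polynomial P in t, obtained from f (tau1 s X) by
    s = 1/t and clearing denominators, whose leading coefficient does not
    vanish at X0 and which is zero whenever tau0 t X is in W.  As no tau0 t X0
    is in W, the polynomials in t with the latter property have no common root
    over X0, so one of them specializes to 1 there.  Its resultant with P,
    multiplied by the leading coefficient of P, separates X0 from the union. *)
Lemma sweep_closed (W : set (rep k d)) (tau0 tau1 : k -> rep k d -> rep k d) :
  zariski_closed W ->
  (forall a, matrix_over regular_poly (fun x => tau0 x.2 x.1 a)) ->
  (forall a, matrix_over regular_poly (fun x => tau1 x.2 x.1 a)) ->
  (forall X t, t != 0 -> W (tau0 t X) -> W (tau1 t^-1 X)) ->
  zariski_closed [set X | (exists t, W (tau0 t X)) \/ W (tau1 0 X)].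
Proof.
move=> Wcl tau0r tau1r compat; apply/closedP=> X0 /not_orP[/forallNP nW0 nW1].
have /closedP sep := Wcl.
have pullback (tau : k -> rep k d -> rep k d)
    (taur : forall a, matrix_over regular_poly (fun x => tau x.2 x.1 a)) f :
    regular f ->
    exists P : {poly coef}, forall X t, f (tau t X) = (spec X P).[t].
  move=> fr; have := regular_subst (F := fun x => tau x.2 x.1) fr
    regular_poly_ring taur.
  by case=> P PE; exists P => X t; rewrite -PE.
have [f [fr fW fX0]] := sep _ nW1.
have [p pE] := pullback _ tau1r _ fr.
pose D := size p.
(* The reversal of p in degree D = size p, one more than its degree, so that
   the constant coefficient of P is 0. *)
pose P := \poly_(i < D.+1) p`_(D - i).
have PE X t : t != 0 -> (spec X P).[t] = t ^+ D * (spec X p).[t^-1].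
  move=> tnz; have wide n (r : {poly coef}) y : (size r <= n)%N ->
      (spec X r).[y] = \sum_(i < n) meval (coords X) r`_i * y ^+ i.
    move=> rn; rewrite (horner_coef_wide _ (leq_trans (size_poly _ _) rn)).
    by apply: eq_bigr => i _; rewrite coef_map.
  rewrite (wide _ _ t (size_poly _ _)) (wide _ _ _ (leqnSn D)) mulr_sumr.
  rewrite (reindex_inj rev_ord_inj); apply: eq_bigr => -[i /= iD] _.
  rewrite coef_poly ltnS subSS leq_subr subKn // mulrCA exprVn.
  by rewrite exprB ?unitfE.
have P0 X : (spec X P).[0] = 0.
  rewrite horner_coef0 coef_map coef_poly /= subn0 /D.
  by rewrite nth_default ?meval0.
have PW X t : W (tau0 t X) -> (spec X P).[t] = 0.
  have [->|tnz] := eqVneq t 0 => [_|WX]; first exact: P0.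
  by rewrite PE // -pE fW ?mulr0 //; exact: compat.
have p0E X : meval (coords X) p`_0 = f (tau1 0 X).
  by rewrite pE horner_coef0 coef_map.
have Pp0 : P`_D = p`_0 by rewrite coef_poly ltnSn subnn.
have p0X0 : meval (coords X0) p`_0 != 0 by rewrite p0E.
have p0nz : p`_0 != 0.
  by apply: contraNneq p0X0 => ->; rewrite meval0.
have Dgt0 : (0 < D)%N.
  rewrite lt0n; apply: contraNneq p0nz => D0.
  by rewrite nth_default // -/D D0.
have sP : size P = D.+1.
  by apply: size_poly_eq; rewrite subnn.
have lP : lead_coef P = p`_0 by rewrite lead_coefE sP.
(* The specializations at X0 of the polynomials in t that vanish whenever
   tau0 t X is in W. *)
pose J u := exists2 R : {poly coef},
  (forall X t, W (tau0 t X) -> (spec X R).[t] = 0) & spec X0 R = u.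
have [R RW R1] : J 1.
  apply: common_root_free => [u v [R RW Ru] [S SW Sv]|u v [S SW Sv]||t].
  - exists (R + S); last by rewrite rmorphD /= Ru Sv.
    by move=> X t WX; rewrite rmorphD hornerD /= RW // SW // addr0.
  - have mCK X : spec X (map_poly (@mpolyC _ k) u) = u.
      rewrite -map_poly_comp map_poly_id // => c _ /=; exact: mevalC.
    exists (map_poly (@mpolyC _ k) u * S); last by rewrite rmorphM /= Sv mCK.
    by move=> X t WX; rewrite rmorphM hornerM /= SW // mulr0.
  - exists (spec X0 P); first by exists P.
    by rewrite map_poly_eq0_id0 ?lP // -lead_coef_eq0 lP.
  - have [g [gr gW gX0]] := sep _ (nW0 t).
    have [S SE] := pullback _ tau0r _ gr.
    exists (spec X0 S); last by rewrite /root -SE.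
    by exists S => // X s WX; rewrite -SE gW.
(* Adding a multiple of P keeps the vanishing property and the coprimality with
   P over X0, and gives a leading coefficient that does not vanish at X0. *)
pose q := R + P * 'X^(size R).
have sXP : size (P * 'X^(size R)) = (size R + D.+1)%N.
  have Pnz : P != 0 by rewrite -size_poly_gt0 sP.
  by rewrite (size_mulXn _ Pnz) sP addnC.
have sq : size q = (size R + D.+1)%N.
  by rewrite /q addrC size_polyDl sXP // addnS ltnS leq_addr.
have lq : lead_coef q = p`_0.
  rewrite /q addrC lead_coefDl; first by rewrite lead_coef_Mmonic ?monicXn.
  by rewrite sXP addnS ltnS leq_addr.
have qW X t : W (tau0 t X) -> (spec X q).[t] = 0.
  move=> WX; rewrite /q rmorphD rmorphM hornerD hornerM /=.
  by rewrite RW // PW // mul0r addr0.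
exists (fun X => meval (coords X) (p`_0 * resultant P q)); split=> /=.
- by exists (p`_0 * resultant P q).
- move=> X [[t WX]|WX]; last by rewrite mevalM p0E fW // mul0r.
  have sq1 : (1 < size q)%N by rewrite sq addnS ltnS addn_gt0 Dgt0 orbT.
  have sP1 : (1 < size P)%N by rewrite sP ltnS.
  have [[u v] _ /(congr1 (fun s => (spec X s).[t]))] :=
    resultant_in_ideal sP1 sq1.
  rewrite map_polyC hornerC /= rmorphD !rmorphM hornerD !hornerM /= PW // qW //.
  by rewrite !mulr0 addr0 => ->; rewrite mulr0.
- rewrite mevalM mulf_neq0 // resultant_map ?lP ?lq //= resultant_eq0.
  rewrite -leqNgt /q rmorphD /= R1 /= rmorphM /=.
  set g := gcdp _ _.
  have gP : g %| spec X0 P by rewrite dvdp_gcdl.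
  have : g %| 1 + spec X0 P * spec X0 'X^(size R) by rewrite dvdp_gcdr.
  rewrite dvdp_addl ?dvdp_mulr // dvdp1 => /eqP -> //.
Qed.

End ProjectiveLine.

(** * Extensions in terms of quotients and subrepresentations *)

Section QuotientRepresentations.
Variables (k : closedFieldType) (Q : quiver) (c d : dimv Q).
Implicit Types (A : set (rep k d)) (g : forall i, 'M[k]_(c i, d i)).

Definition descends A g : set (rep k c) :=
  [set X | exists2 M, A M & rep_hom X M g].

(** The quotient representation is pinvmx g * X * g, which is linear in X, and
    it is a quotient of X exactly when linear equations in X hold. *)
Lemma descends_closed A g :
  zariski_closed A -> (forall i, row_full (g i)) ->
  zariski_closed (descends A g).
Proof.
move=> Acl gfull; have ring := @regular_ring k Q c.
pose F (X : rep k c) : rep k d :=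
  fun a => pinvmx (g (src a)) *m (X a *m g (tgt a)).
have Xg : forall a, matrix_over (@regular k Q c) (fun X => X a *m g (tgt a)).
  move=> a; apply: (matrix_overM ring).
    exact: regular_entry.
  exact: (matrix_over_const ring).
have FX : forall a, matrix_over (@regular k Q c) (fun X => F X a).
  move=> a; apply: (matrix_overM ring).
    exact: (matrix_over_const ring).
  exact: Xg.
pose J := {a : arrow Q & ('I_(c (src a)) * 'I_(d (tgt a)))%type}.
pose z (j : J) (X : rep k c) :=
  (X (tag j) *m g (tgt (tag j)) - g (src (tag j)) *m F X (tag j))
    (tagged j).1 (tagged j).2.
have -> : descends A g = F @^-1` A `&` [set X | forall j, z j X = 0].
  apply/seteqP; split=> X.
    case=> M AM Xg'; have FM : F X = M.
      apply: functional_extensionality_dep => a.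
      by rewrite /F Xg' mulmxA mulVpmx // mul1mx.
    split=> [|j]; first by rewrite /= FM.
    by rewrite /z FM Xg' subrr mxE.
  case=> AF z0; exists (F X) => // a; apply/eqP; rewrite -subr_eq0; apply/eqP.
  by apply/matrixP=> x y; rewrite [RHS]mxE; exact: (z0 (Tagged _ (x, y))).
apply: closedI; first exact: closed_preimage.
apply: closed_zeros => -[a [x y]].
apply: (matrix_overD ring); first exact: Xg.
apply: (matrix_overN ring).
apply: (matrix_overM ring); last exact: FX.
exact: (matrix_over_const ring).
Qed.

Lemma descends_act A g (h : forall i, 'M[k]_(c i)) X :
  (forall i, h i \in unitmx) ->
  descends A g (base_change_act h X) <-> descends A (fun i => h i *m g i) X.
Proof.
move=> hU; split=> -[M AM gM]; exists M => // a; have := gM a.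
  rewrite /base_change_act => E.
  by rewrite -[RHS]mulmxA -E !mulmxA mulmxV // mul1mx.
by rewrite /base_change_act -!mulmxA => ->; rewrite mulKmx.
Qed.

(** Two surjections with the same kernel differ by a base change of the target,
    under which A is stable: only the kernel of g matters. *)
Lemma descends_sub A g g' : stable A ->
  (forall i, row_full (g i)) -> (forall i, row_full (g' i)) ->
  (forall i, kermx (g i) <= kermx (g' i))%MS ->
  descends A g `<=` descends A g'.
Proof.
move=> stA gfull g'full kers X [M AM XM].
pose u i := pinvmx (g i) *m g' i.
have guE i : g i *m u i = g' i.
  by apply: (row_full_factor (f := kermx (g i)));
     rewrite ?submx_refl //; exact/sub_kermxP.
have uU i : u i \in unitmx.
  rewrite -row_full_unit; have /row_fullP[w wE] := g'full i.
  by apply/row_fullP; exists (w *m g i); rewrite -mulmxA guE.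
exists (base_change_act u M); first exact: stA.
move=> a; clearbody u; rewrite -(guE (src a)) -(guE (tgt a)) /base_change_act.
rewrite -!mulmxA mulKVmx //.
by rewrite !mulmxA XM.
Qed.

Lemma extensions_quotP A (e : dimv Q) X : c = d + e ->
  extensions A [set: rep k e] X <->
  exists g, (forall i, row_full (g i)) /\ descends A g X.
Proof.
move=> cE; split=> [[M [N [AM _ [f [g [_ gX ex]]]]]]|[g [gfull [M AM XM]]]].
  by exists g; split=> [i|]; [have [] := ex i | exists M].
have dimE i : c i = (d i + e i)%N by rewrite cE ffunE.
pose f i := projT1 (cid (ker_exists (gfull i) (dimE i))).
have fE i : row_free (f i) /\ (f i == kermx (g i))%MS.
  exact: projT2 (cid (ker_exists (gfull i) (dimE i))).
have [N NX] := ker_rep XM fE.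
exists M, N; split=> //; exists f, g; split=> // i.
by have [] := fE i.
Qed.

Lemma extensions_subP (e : dimv Q) (B : set (rep k e)) X : c = d + e ->
  extensions [set: rep k d] B X <->
  exists f : forall i, 'M[k]_(e i, c i),
    (forall i, row_free (f i)) /\ exists2 N, B N & rep_hom N X f.
Proof.
move=> cE; split=> [[M [N [_ BN [f [g [fX _ ex]]]]]]|[f [ffree [N BN NX]]]].
  by exists f; split=> [i|]; [have [] := ex i | exists N].
have dimE i : c i = (d i + e i)%N by rewrite cE ffunE.
pose g i := projT1 (cid (coker_exists (ffree i) (dimE i))).
have gE i : row_full (g i) /\ (f i == kermx (g i))%MS.
  exact: projT2 (cid (coker_exists (ffree i) (dimE i))).
have [M XM] := coker_rep NX gE.
exists M, N; split=> //; exists f, g; split=> // i.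
by have [] := gE i.
Qed.

End QuotientRepresentations.

(** * Extensions by a simple representation form a closed set *)

Lemma conform_unit (k : closedFieldType) (n m : nat) (H : 'M[k]_n) :
  H \in unitmx -> conform_mx (1%:M : 'M_m) H \in unitmx.
Proof.
move=> HU; have [e|ne] := eqVneq n m.
  by case: m / e; rewrite conform_mx_id.
by rewrite nonconform_mx ?ne // unitmx1.
Qed.

Lemma invmx_conform (k : closedFieldType) (n m : nat) (H : 'M[k]_n) :
  invmx (conform_mx (1%:M : 'M_m) H) = conform_mx (1%:M : 'M_m) (invmx H).
Proof.
have [e|ne] := eqVneq n m; first by case: m / e; rewrite !conform_mx_id.
by rewrite !nonconform_mx ?ne // invmx1.
Qed.

Lemma conform_over (k : closedFieldType) (T : Type) (S : set (T -> k))
    (n m : nat) (H : T -> 'M[k]_n) : function_ring S ->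
  matrix_over S H -> matrix_over S (fun x => conform_mx (1%:M : 'M_m) (H x)).
Proof.
move=> ringS HS; have [e|ne] := eqVneq n m.
  by case: m / e => i j; under_mem conform_mx_id; exact: HS.
move=> i j; apply: mem_eq1 => [x|]; first by rewrite nonconform_mx ?ne.
exact: matrix_over_const.
Qed.

Lemma row_full_mull (k : closedFieldType) (m n : nat) (h : 'M[k]_m)
    (g : 'M[k]_(m, n)) : h \in unitmx -> row_full g -> row_full (h *m g).
Proof.
move=> hU /row_fullP[w wE]; apply/row_fullP; exists (w *m invmx h).
by rewrite mulmxA mulmxKV.
Qed.

Section Shears.
Variables (k : closedFieldType) (m : nat) (j j' : 'I_m).
Hypothesis jS : nat_of_ord j' = j.+1.

Let jj' : j == j' = false.
Proof. by rewrite -val_eqE /= jS ltn_eqF. Qed.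

Definition in_flag (n : nat) (v : 'rV[k]_m) : Prop :=
  forall y : 'I_m, (n < y)%N -> v 0 y = 0.

(** Every line in the span of e_0, ..., e_j' is moved into the span of
    e_0, ..., e_j by some [shear t], or by [swapped_shear 0].  For t nonzero,
    [shear t] and [swapped_shear t^-1] do so for the same lines. *)
Definition shear (t : k) : 'M[k]_m := 1%:M + t *: delta_mx j j'.
Definition swapped_shear (t : k) : 'M[k]_m := tperm_mx j j' *m shear t.

Lemma mul_shear t : shear t *m shear (- t) = 1%:M.
Proof.
rewrite /shear mulmxDl mul1mx mulmxDr mulmx1 -scalemxAr -scalemxAl.
rewrite mul_delta_mx_0 1?eq_sym ?jj' // !scaler0 addr0.
by rewrite scaleNr subrK.
Qed.

Lemma shear_unit t : shear t \in unitmx.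
Proof. by have /mulmx1_unit[] := mul_shear t. Qed.

Lemma invmx_shear t : invmx (shear t) = shear (- t).
Proof.
by rewrite -[RHS]mul1mx -(mulVmx (shear_unit t)) -mulmxA mul_shear mulmx1.
Qed.

Lemma swapped_shear_unit t : swapped_shear t \in unitmx.
Proof. by rewrite unitmx_mul shear_unit unitmx_perm. Qed.

Lemma invmx_swapped_shear t :
  invmx (swapped_shear t) = shear (- t) *m tperm_mx j j'.
Proof.
have E : swapped_shear t *m (shear (- t) *m tperm_mx j j') = 1%:M.
  rewrite mulmxA -(mulmxA _ (shear t)) mul_shear mulmx1.
  by rewrite -perm_mxM tperm2 perm_mx1.
by rewrite -[RHS]mul1mx -(mulVmx (swapped_shear_unit t)) -mulmxA E mulmx1.
Qed.

Lemma shearE (v : 'rV[k]_m) t y :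
  (v *m shear t) 0 y = v 0 y + t * v 0 j *+ (y == j').
Proof.
rewrite /shear mulmxDr mulmx1 -scalemxAr !mxE (bigD1 j) //= big1 => [|x xj].
  by rewrite addr0 !mxE eqxx /= eq_sym -mulrnAr mulr_natr.
by rewrite !mxE (negPf xj) mulr0.
Qed.

Lemma in_flag_shear (v : 'rV[k]_m) t :
  in_flag j (v *m shear t) <->
  in_flag j' v /\ v 0 j' + t * v 0 j = 0.
Proof.
split=> [vt|[vj' v0] y jy].
  split=> [y j'y|]; last first.
    by have := vt j'; rewrite shearE eqxx; apply; rewrite jS.
  have := vt y; rewrite shearE -val_eqE /= gtn_eqF // addr0; apply.
  by apply: ltn_trans j'y; rewrite jS.
rewrite shearE; have [->|yj'] := eqVneq y j'; first exact: v0.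
by rewrite addr0 vj' // ltn_neqAle jS jy andbT -jS eq_sym.
Qed.

Lemma in_flag_swapped_shear (v : 'rV[k]_m) t :
  in_flag j (v *m swapped_shear t) <->
  in_flag j' v /\ v 0 j + t * v 0 j' = 0.
Proof.
have vP y : (v *m tperm_mx j j') 0 y = v 0 (tperm j j' y).
  by rewrite -xcolE mxE.
rewrite mulmxA in_flag_shear !vP tpermL tpermR.
have -> // : in_flag j' (v *m tperm_mx j j') <-> in_flag j' v.
have fixed (y : 'I_m) : (j' < y)%N -> tperm j j' y = y.
  move=> j'y; rewrite tpermD // -val_eqE /= ltn_eqF //.
  by apply: ltn_trans j'y; rewrite jS.
by split=> vj y j'y; have := vj y j'y; rewrite vP fixed.
Qed.

End Shears.

Section SimpleSubrepresentation.
Variables (k : closedFieldType) (Q : quiver) (d : dimv Q) (i0 : vertex Q).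
Variable A : set (rep k d).
Hypotheses (stA : stable A) (Acl : zariski_closed A).

Local Notation c := (d + sigma i0 : dimv Q).
Local Notation m := (c i0).

(** The vector v spans the kernel of g, a simple subrepresentation of X with
    quotient in A; the index j bounds the position of this line in the standard
    flag. *)
Definition flag_extensions (j : nat) : set (rep k c) :=
  [set X | exists g (v : 'rV[k]_m), [/\ forall i, row_full (g i), v != 0,
     in_flag j v, v *m g i0 = 0 & descends A g X]].

(** [conform_mx] also puts H at the other vertices whose dimension happens to be
    that of i0.  This is harmless, since [flag_extensions] restricts the kernel
    at i0 only. *)
Definition local_act (H : 'M[k]_m) : rep k c -> rep k c :=
  base_change_act (fun i => conform_mx 1%:M H).

Lemma local_actP j H X : H \in unitmx ->
  flag_extensions j (local_act H X) <->
  exists g (v : 'rV[k]_m), [/\ forall i, row_full (g i), v != 0,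
     in_flag j (v *m H), v *m g i0 = 0 & descends A g X].
Proof.
move=> HU; have hU i : conform_mx (1%:M : 'M[k]_(c i)) H \in unitmx.
  exact: conform_unit.
split=> -[g [v [gfull vnz vj vg XA]]].
  exists (fun i => conform_mx 1%:M H *m g i), (v *m invmx H); split.
  - by move=> i; exact: row_full_mull.
  - apply: contraNneq vnz => v0.
    by rewrite -(mulmxKV HU v) v0 mul0mx.
  - by rewrite mulmxKV.
  - by rewrite conform_mx_id mulmxA mulmxKV.
  - exact/descends_act.
exists (fun i => invmx (conform_mx 1%:M H) *m g i), (v *m H); split=> //.
- by move=> i; apply: row_full_mull => //; rewrite unitmx_inv.
- apply: contraNneq vnz => v0.
  by rewrite -(mulmxK HU v) v0 mul0mx.
- by rewrite conform_mx_id mulmxA mulmxK.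
- apply/descends_act => //; case: XA => M AM XM; exists M => // a.
  by rewrite !mulKVmx // XM.
Qed.

(** The representations admitted at j' are those moved by a member of the
    projective line of shears to one admitted at j, by [in_flag_shear] and
    [in_flag_swapped_shear]. *)
Lemma flag_extensions_step (j j' : 'I_m) : nat_of_ord j' = j.+1 ->
  zariski_closed (flag_extensions j) -> zariski_closed (flag_extensions j').
Proof.
move=> jS Ucl; have ring := @regular_poly_ring k Q c.
have shear_over (f : rep k c * k -> k) : regular_poly f ->
    matrix_over (@regular_poly k Q c) (fun x => shear j j' (f x)).
  move=> fr; apply: (matrix_overD ring); first exact: matrix_over_const.
  by apply: (matrix_overZ ring) => //; exact: matrix_over_const.
have Nparam : regular_poly (fun x : rep k c * k => - x.2).
  exact/(function_ring_opp ring)/regular_poly_param.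
have act_over (H H' : k -> 'M[k]_m) : (forall t, invmx (H t) = H' t) ->
    matrix_over (@regular_poly k Q c) (fun x => H x.2) ->
    matrix_over (@regular_poly k Q c) (fun x => H' x.2) ->
    forall a, matrix_over (@regular_poly k Q c)
                (fun x => local_act (H x.2) x.1 a).
  move=> HV HS H'S a; apply: (matrix_overM ring); last exact: conform_over.
  apply: (matrix_overM ring); last exact: regular_poly_entry.
  move=> x y; apply: mem_eq1 => [z|]; first by rewrite invmx_conform HV.
  exact: (conform_over ring H'S).
have -> : flag_extensions j' =
    [set X | (exists t, flag_extensions j (local_act (shear j j' t) X)) \/
             flag_extensions j (local_act (swapped_shear j j' 0) X)].
  apply/seteqP; split=> X.
    case=> g [v [gfull vnz vj' vg XA]].
    have [vj|vj] := eqVneq (v 0 j) 0.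
      right; apply/local_actP; first exact: swapped_shear_unit.
      exists g, v; split=> //; apply/in_flag_swapped_shear => //.
      by rewrite vj mul0r addr0.
    left; exists (- v 0 j' / v 0 j); apply/local_actP; first exact: shear_unit.
    exists g, v; split=> //; apply/in_flag_shear => //.
    by rewrite mulfVK // addrN.
  case=> [[t]|] /local_actP E.
    have [g [v [gfull vnz vj vg XA]]] := E (shear_unit jS t).
    by exists g, v; split=> //; have [] := (in_flag_shear jS _ _).1 vj.
  have [g [v [gfull vnz vj vg XA]]] := E (swapped_shear_unit jS 0).
  by exists g, v; split=> //; have [] := (in_flag_swapped_shear jS _ _).1 vj.
apply: (sweep_closed (tau0 := fun t => local_act (shear j j' t))
  (tau1 := fun t => local_act (swapped_shear j j' t))) => //
  [||X t tnz /local_actP E].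
- apply: act_over (invmx_shear jS) _ _; apply: shear_over => //.
  exact: regular_poly_param.
- apply: act_over (invmx_swapped_shear jS) _ _.
    apply: (matrix_overM ring); first exact: matrix_over_const.
    by apply: shear_over; exact: regular_poly_param.
  by apply: (matrix_overM ring); [exact: shear_over | exact: matrix_over_const].
have [g [v [gfull vnz vj vg XA]]] := E (shear_unit jS t).
apply/local_actP; first exact: swapped_shear_unit.
exists g, v; split=> //; apply/in_flag_swapped_shear => //.
have [vj' v0] := (in_flag_shear jS _ _).1 vj; split=> //.
by rewrite -[v 0 j](mulKf tnz) -mulrDr addrC v0 mulr0.
Qed.

Let mE : m = (d i0).+1.
Proof. by rewrite !ffunE eqxx; exact: addn1. Qed.

(** There is only one line in the span of e_0, so all admissible g have the same
    kernel: it is that line at i0 and zero at the other vertices. *)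
Lemma flag_extensions_base : zariski_closed (flag_extensions 0).
Proof.
have [[g [v [gfull vnz v0 vg]]]|nog] :=
    pselect (exists g (v : 'rV[k]_m),
      [/\ forall i, row_full (g i : 'M_(c i, d i)), v != 0,
          in_flag 0 v & v *m g i0 = 0]);
  last first.
  suff -> : flag_extensions 0 = set0 by exact: closed_set0.
  apply/seteqP; split=> X //= [g [v [gfull vnz v0 vg _]]].
  by apply: nog; exists g, v.
suff -> : flag_extensions 0 = descends A g by exact: descends_closed.
apply/seteqP; split=> X; last by exists g, v.
case=> g' [v' [g'full v'nz v'0 v'g' XA]].
apply: descends_sub XA => // i.
have [->|ne] := eqVneq i i0; last first.
  suff -> : kermx (g' i) = 0 by exact: sub0mx.
  apply/eqP; rewrite -mxrank_eq0 mxrank_ker (eqP (g'full i)).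
  by rewrite !ffunE (negPf ne) [X in (X - _)%N]addn0 subnn.
have o0P : (0 < m)%N by rewrite mE.
pose o0 : 'I_m := Ordinal o0P.
have lineE (w : 'rV[k]_m) : in_flag 0 w -> w = w 0 o0 *: delta_mx 0 o0.
  move=> w0; apply/rowP=> y; rewrite !mxE eqxx /=.
  have [->|yo] := eqVneq y o0; first by rewrite mulr1.
  by rewrite mulr0 w0 // lt0n; apply: contraNneq yo => y0; apply/eqP/val_inj.
have rk1 : \rank (kermx (g' i0)) = 1%N.
  by rewrite mxrank_ker (eqP (g'full i0)) mE subSnn.
have v'ker : (v' <= kermx (g' i0))%MS by exact/sub_kermxP.
have kerE : (kermx (g' i0) <= v')%MS.
  by rewrite -(mxrank_leqif_sup v'ker).2 rk1 rank_rV v'nz.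
apply: (submx_trans kerE); apply/sub_kermxP.
have v'o : v' 0 o0 != 0.
  by apply: contraNneq v'nz => v'o; rewrite (lineE _ v'0) v'o scale0r.
have vo : v 0 o0 != 0.
  by apply: contraNneq vnz => vo; rewrite (lineE _ v0) vo scale0r.
rewrite (lineE _ v'0) -scalemxAl; apply/eqP; rewrite scaler_eq0 (negPf v'o) /=.
have := vg; rewrite {1}(lineE _ v0) -scalemxAl => /eqP.
by rewrite scaler_eq0 (negPf vo).
Qed.

Lemma flag_extensions_closed (j : 'I_m) : zariski_closed (flag_extensions j).
Proof.
case: j => j /=; elim: j => [|j IH] jm; first exact: flag_extensions_base.
have jm' := ltnW jm.
by apply: (@flag_extensions_step (Ordinal jm') (Ordinal jm)); last exact: IH.
Qed.

(** A surjection onto a representation of dimension d has a kernel of dimension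
    1 at i0 and of dimension 0 elsewhere, whatever line this kernel is. *)
Lemma extensions_simple_closed :
  zariski_closed (extensions A [set: rep k (sigma i0)] (c := c)).
Proof.
have dm : (d i0 < m)%N by rewrite mE.
suff -> : extensions A [set: rep k (sigma i0)] (c := c) =
    flag_extensions (Ordinal dm) by exact: flag_extensions_closed.
apply/seteqP; split=> X.
  move=> /extensions_quotP[//|g [gfull XA]].
  have : kermx (g i0) != 0.
    by rewrite -mxrank_eq0 mxrank_ker (eqP (gfull i0)) mE subSnn.
  case/rowV0Pn=> v /sub_kermxP vg vnz; exists g, v; split=> // y /=.
  by move: (ltn_ord y); rewrite [X in (_ < X)%N -> _]mE ltnS leqNgt => /negPf->.
case=> g [v [gfull _ _ _ XA]]; apply/extensions_quotP => //.
by exists g.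
Qed.

End SimpleSubrepresentation.

(** * Irreducibility of extensions *)

Section Irreducibility.
Variables (k : closedFieldType) (Q : quiver).
Implicit Types c d e : dimv Q.

(** Zero sets of single functions suffice to test irreducibility, since every
    closed set is an intersection of such sets. *)
Lemma irreducibleP d (A : set (rep k d)) :
  irreducible A <-> A !=set0 /\
    forall f1 f2, regular f1 -> regular f2 ->
      (exists2 X, A X & f1 X != 0) -> (exists2 X, A X & f2 X != 0) ->
      exists X, [/\ A X, f1 X != 0 & f2 X != 0].
Proof.
split=> -[A0 irrA]; split=> //.
  move=> f1 f2 r1 r2 [X1 AX1 fX1] [X2 AX2 fX2].
  pose Z (f : rep k d -> k) : set (rep k d) := [set X | f X = 0].
  have Zcl f : regular f -> zariski_closed (Z f).
    move=> fr; have := @closed_zeros k Q d unit (fun=> f) (fun=> fr).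
    by congr zariski_closed; apply/seteqP; split=> X //=; apply.
  apply: contrapT => noX.
  have : A `<=` Z f1 `|` Z f2.
    move=> X AX; have [f1X|f1X] := eqVneq (f1 X) 0; first by left.
    right; apply/eqP/negPn/negP => f2X; apply: noX; by exists X.
  case/(irrA _ _ (Zcl _ r1) (Zcl _ r2)).
    by move/(_ X1 AX1); apply/eqP.
  by move/(_ X2 AX2); apply/eqP.
move=> Z1 Z2 /closedP sep1 /closedP sep2 AZ; apply: contrapT => /not_orP[].
move=> /existsNP[X1 /not_implyP[AX1 /sep1[f1 [r1 v1 n1]]]].
move=> /existsNP[X2 /not_implyP[AX2 /sep2[f2 [r2 v2 n2]]]].
have [X [AX /eqP f1X /eqP f2X]] := irrA f1 f2 r1 r2
  (ex_intro2 _ _ X1 AX1 n1) (ex_intro2 _ _ X2 AX2 n2).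
by case: (AZ X AX) => [/v1|/v2].
Qed.

Section AwayFrom.
Variable delta : {poly k}.

(** Functions of t which are fractions with a power of delta as denominator;
    their values at the zeros of delta are irrelevant. *)
Definition fraction_along : set (k -> k) :=
  [set f | exists n (p : {poly k}),
    forall t, delta.[t] != 0 -> f t * delta.[t] ^+ n = p.[t]].

Lemma fraction_along_ring : function_ring fraction_along.
Proof.
split=> [c|f g [n [p fE]] [l [q gE]]|f g [n [p fE]] [l [q gE]]].
- by exists 0%N, c%:P => t _; rewrite mulr1 hornerC.
- exists (n + l)%N, (p * delta ^+ l + q * delta ^+ n) => t tnz.
  rewrite hornerD !hornerM !horner_exp -fE // -gE // exprD; ring.
- exists (n + l)%N, (p * q) => t tnz.
  rewrite hornerM -fE // -gE // exprD; ring.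
Qed.

Lemma fraction_along_poly (p : {poly k}) : fraction_along (horner p).
Proof. by exists 0%N, p => t _; rewrite mulr1. Qed.

Lemma fraction_along_inv (p q : {poly k}) : delta = p * q ->
  fraction_along (fun t => p.[t]^-1).
Proof.
move=> dE; exists 1%N, q => t; rewrite dE hornerM mulf_eq0 expr1.
by case/norP=> pt _; rewrite mulKf.
Qed.

Lemma fraction_along_eq (f g : k -> k) :
  (forall t, delta.[t] != 0 -> f t = g t) ->
  fraction_along g -> fraction_along f.
Proof. by move=> fg [n [p gE]]; exists n, p => t tnz; rewrite fg ?gE. Qed.

End AwayFrom.

Section Extensions.
Variables (c d e : dimv Q) (A : set (rep k d)).
Hypotheses (cE : c = d + e) (stA : stable A) (irrA : irreducible A).

Let dc i : (d i <= c i)%N.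
Proof. by rewrite cE ffunE; exact: leq_addr. Qed.

Let g0 i : 'M[k]_(c i, d i) := pid_mx (d i).

Let g0full i : row_full (g0 i).
Proof. by rewrite /row_full rank_pid_mx. Qed.

Let s0 i : 'M[k]_(d i, c i) := pinvmx (g0 i).

Let s0g0 i : s0 i *m g0 i = 1%:M.
Proof. exact: mulVpmx. Qed.

(** For h = 1 these are the extensions in block form for the standard projection
    g0 with section s0: M is the quotient, and Y, killed by g0, holds the
    remaining blocks. *)
Definition extension_param (h : forall i, 'M[k]_(c i)) (M : rep k d)
    (Y : rep k c) : rep k c :=
  base_change_act h (fun a => g0 (src a) *m M a *m s0 (tgt a) + Y a).

Let null (Y : rep k c) := forall a, Y a *m g0 (tgt a) = 0.

Lemma extension_param_in h M Y : (forall i, h i \in unitmx) -> A M -> null Y ->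
  extensions A [set: rep k e] (extension_param h M Y).
Proof.
move=> hU AM Y0; apply: extensions_stable => //; apply/extensions_quotP => //.
exists g0; split=> //; exists M => // a.
by rewrite mulmxDl Y0 addr0 -mulmxA s0g0 mulmx1.
Qed.

(** Gaussian elimination writes any surjection g as L * g0 * U with L and U
    invertible; U does not change the kernel and L is a base change of X. *)
Lemma extension_param_onto X : extensions A [set: rep k e] X ->
  exists h M Y, [/\ forall i, h i \in unitmx, A M, null Y
                  & X = extension_param h M Y].
Proof.
move=> /extensions_quotP => /(_ cE)[g [gfull XA]].
pose L i := col_ebase (g i).
have LU i : L i \in unitmx by exact: col_ebase_unit.
have gE i : g i = L i *m g0 i *m row_ebase (g i).
  by rewrite -{1}(mulmx_ebase (g i)) (eqP (gfull i)).
have : descends A (fun i => L i *m g0 i) X.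
  apply: descends_sub XA => // i; first exact: row_full_mull.
  apply/sub_kermxP; rewrite -[L i *m _](mulmxK (row_ebase_unit (g i))) -gE.
  by rewrite mulmxA mulmx_ker mul0mx.
move/(descends_act _ _ _ LU); set X' := base_change_act _ _.
case=> M AM X'M; exists (fun i => invmx (L i)), M.
exists (fun a => X' a - g0 (src a) *m M a *m s0 (tgt a)); split=> //.
- by move=> i; rewrite unitmx_inv.
- by move=> a; rewrite mulmxBl -[X in _ - X]mulmxA s0g0 mulmx1 X'M subrr.
apply: functional_extensionality_dep => a.
rewrite /extension_param /base_change_act addrC subrK invmxK /X'.
by rewrite /base_change_act !mulmxA mulmxV // mul1mx mulmxK.
Qed.

(** Let f1 and f2 be nonzero at the extensions with parameters (h1, M1, Y1) and
    (h2, M2, Y2).  Irreducibility of A allows M1 and M2 to be replaced by a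
    common M.  On the line joining (h1, Y1) to (h2, Y2), f1 and f2 are then
    fractions in t which are nonzero at 0 and at 1 respectively, with powers of
    the product delta of the determinants of the h_t as denominators, so a
    general t suits both. *)
Lemma extensions_irreducible :
  irreducible (extensions A [set: rep k e] (c := c)).
Proof.
have [[M0 AM0] irr] := (irreducibleP _).1 irrA; apply/irreducibleP; split.
  exists (extension_param (fun=> 1%:M) M0 (fun=> 0)).
  by apply: extension_param_in => // [i|a]; rewrite ?unitmx1 ?mul0mx.
move=> f1 f2 r1 r2.
case=> X1 /extension_param_onto[h1 [M1 [Y1 [hU1 AM1 Y10 X1E]]]] fX1.
case=> X2 /extension_param_onto[h2 [M2 [Y2 [hU2 AM2 Y20 X2E]]]] fX2.
have regM f h Y : regular f ->
    regular (fun M : rep k d => f (extension_param h M Y)).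
  have ring := @regular_ring k Q d.
  move=> fr; apply: regular_subst => // a.
  apply: (matrix_overM ring); last exact: matrix_over_const.
  apply: (matrix_overM ring); first exact: matrix_over_const.
  apply: (matrix_overD ring); last exact: matrix_over_const.
  apply: (matrix_overM ring); last exact: matrix_over_const.
  apply: (matrix_overM ring); first exact: matrix_over_const.
  exact: regular_entry.
have [M [AM f1M f2M]] := irr _ _ (regM f1 h1 Y1 r1) (regM f2 h2 Y2 r2)
  (ex_intro2 _ _ M1 AM1 (etrans (congr1 (fun X => f1 X != 0) (esym X1E)) fX1))
  (ex_intro2 _ _ M2 AM2 (etrans (congr1 (fun X => f2 X != 0) (esym X2E)) fX2)).
pose line m n (U V : 'M[k]_(m, n)) : 'M[{poly k}]_(m, n) :=
  map_mx polyC U + 'X *: map_mx polyC (V - U).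
have lineE m n (U V : 'M[k]_(m, n)) t :
    map_mx (horner_eval t) (line m n U V) = U + t *: (V - U).
  apply/matrixP=> x y.
  by rewrite !mxE /horner_eval hornerD hornerM hornerX !hornerC.
pose H i := line _ _ (h1 i) (h2 i).
pose h t i := map_mx (horner_eval t) (H i).
pose Y t : rep k c := fun a => map_mx (horner_eval t) (line _ _ (Y1 a) (Y2 a)).
pose delta := \prod_i \det (H i).
have detE t i : \det (h t i) = (\det (H i)).[t] by rewrite det_map_mx.
have hU t i : delta.[t] != 0 -> h t i \in unitmx.
  rewrite unitmxE unitfE detE; apply: contraNneq => Dt0.
  by rewrite /delta (bigD1 i) //= hornerM Dt0 mul0r.
have h0 : h 0 = h1.
  by apply: functional_extensionality_dep => i; rewrite /h lineE scale0r addr0.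
have hh1 : h 1 = h2.
  apply: functional_extensionality_dep => i.
  by rewrite /h lineE scale1r addrC subrK.
have Y0 : Y 0 = Y1.
  by apply: functional_extensionality_dep => a; rewrite /Y lineE scale0r addr0.
have YY1 : Y 1 = Y2.
  apply: functional_extensionality_dep => a.
  by rewrite /Y lineE scale1r addrC subrK.
have Ynull t : null (Y t).
  move=> a; rewrite /Y lineE mulmxDl -scalemxAl mulmxBl Y10 Y20.
  by rewrite subrr scaler0 addr0.
have ring := fraction_along_ring delta.
have poly_over m n (U : 'M[{poly k}]_(m, n)) :
    matrix_over (fraction_along delta) (fun t => map_mx (horner_eval t) U).
  move=> x y; apply: mem_eq1 (fraction_along_poly _ (U x y)) => t.
  by rewrite mxE.
have frac f : regular f ->
    fraction_along delta (fun t => f (extension_param (h t) M (Y t))).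
  move=> fr; apply: (regular_subst fr ring) => a.
  apply: (matrix_overM ring); last exact: poly_over.
  apply: (matrix_overM ring); last first.
    by apply: (matrix_overD ring); [exact: matrix_over_const|exact: poly_over].
  move=> x y; apply: (@fraction_along_eq _ _
    (fun t => ((\det (H (src a))).[t])^-1 *
              (map_mx (horner_eval t) (\adj (H (src a)))) x y)).
    by move=> t /hU tU; rewrite /invmx tU mxE detE map_mx_adj.
  have [_ _ SM] := ring; apply: SM; last exact: poly_over.
  by apply: fraction_along_inv; rewrite /delta (bigD1 (src a)).
have d0 : delta.[0] != 0.
  rewrite /delta horner_prod; apply/prodf_neq0 => i _.
  by rewrite -detE h0 -unitfE -unitmxE.
have d1 : delta.[1] != 0.
  rewrite /delta horner_prod; apply/prodf_neq0 => i _.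
  by rewrite -detE hh1 -unitfE -unitmxE.
have [[n1 [p1 p1E]] [n2 [p2 p2E]]] := (frac f1 r1, frac f2 r2).
have p1nz : p1 != 0.
  apply: contraTneq f1M => p10; have := p1E 0 d0.
  rewrite h0 Y0 p10 horner0 => /eqP.
  by rewrite mulf_eq0 expf_eq0 (negPf d0) andbF orbF => ->.
have p2nz : p2 != 0.
  apply: contraTneq f2M => p20; have := p2E 1 d1.
  rewrite hh1 YY1 p20 horner0 => /eqP.
  by rewrite mulf_eq0 expf_eq0 (negPf d1) andbF orbF => ->.
have dnz : delta != 0.
  by apply: contraNneq d0 => ->; rewrite horner0.
have /closed_nonrootP[t] : p1 * p2 * delta != 0 by rewrite !mulf_neq0.
rewrite /root !hornerM !mulf_eq0 !negb_or -andbA => /and3P[p1t p2t dt].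
exists (extension_param (h t) M (Y t)); split.
- by apply: extension_param_in => // i; exact: hU.
- by apply: contraNneq p1t => f0; rewrite -p1E // f0 mul0r.
- by apply: contraNneq p2t => f0; rewrite -p2E // f0 mul0r.
Qed.

End Extensions.

End Irreducibility.

(** * Words and the degenerate Serre relations *)

Section Words.
Variables (k : closedFieldType) (Q : quiver).
Implicit Types c d e : dimv Q.

Definition word (w : seq (vertex Q)) : stable_set k Q :=
  foldr (fun i => ext_mul (full k (sigma i))) (full k 0) w.

Lemma word_cat u v : word (u ++ v) = ext_mul (word u) (word v).
Proof.
by elim: u => [|i u IH] /=; rewrite ?ext_mul1l // IH ext_mulA.
Qed.

Lemma word_extension w : extension_monoid (word w).
Proof.
elim/last_ind: w => [|w i [irrw clw]].
  split; last by apply/closedP=> X /(_ I).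
  split=> [|Z1 Z2 _ _ /(_ (fun=> 0) I) Z0]; first by exists (fun=> 0).
  have all0 (X : rep k (0 : dimv Q)) : X = fun=> 0.
    by apply: rep_eq0 => i; rewrite ffunE.
  by case: Z0 => Z0; [left|right] => X _; have -> := all0 X.
rewrite -cats1 word_cat /= ext_mul1r; split.
  apply: extensions_irreducible => //; exact: set_of_stable.
apply: extensions_simple_closed => //; exact: set_of_stable.
Qed.

(** By [word_extension], the words form one of the submonoids over which the
    intersection is taken. *)
Lemma composition_set_word (A : stable_set k Q) :
  composition_set A -> exists w, A = word w.
Proof.
move=> /(_ [set B | exists w, B = word w]).
apply=> [_ [w ->]||i]; first exact: word_extension.
  split=> [|_ _ [u ->] [v ->]]; first by exists [::].
  by exists (u ++ v); rewrite word_cat.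
by exists [:: i]; rewrite /= ext_mul1r.
Qed.

Lemma stable_set_full (A : stable_set k Q) :
  @set_of k Q A = setT -> A = full k (dim_of A).
Proof.
case: A => -[d A] stA; rewrite /set_of /dim_of /= => AT; move: stA.
by rewrite AT => stA; apply: val_inj.
Qed.

(** Without arrows from the support of e to that of d, every representation has
    a subrepresentation of dimension e, namely the summand of that dimension. *)
Lemma full_mul d e :
  (forall a : arrow Q, d (tgt a) = 0%N \/ e (src a) = 0%N) ->
  ext_mul (full k d) (full k e) = full k (d + e).
Proof.
move=> noarrow; apply: (@stable_set_full (ext_mul _ _)).
apply/seteqP; split=> // X _; apply/extensions_quotP => //.
pose c : dimv Q := d + e.
have dc i : (d i <= c i)%N by rewrite ffunE; exact: leq_addr.
pose g i : 'M[k]_(c i, d i) := pid_mx (d i).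
have gfull i : row_full (g i) by rewrite /row_full rank_pid_mx.
exists g; split=> //.
exists (fun a => pinvmx (g (src a)) *m (X a *m g (tgt a))) => // a.
have [dt|es] := noarrow a.
  by apply/matrixP=> x y; have := ltn_ord y; rewrite [X in (_ < X)%N]dt.
rewrite (row_full_factor (f := kermx (g (src a)))) ?submx_refl //.
suff -> : kermx (g (src a)) = 0 by rewrite mul0mx.
apply/eqP; rewrite -mxrank_eq0 mxrank_ker (eqP (gfull _)) ffunE es.
by rewrite [X in (X - _)%N]addn0 subnn.
Qed.

Lemma common_kernel (T : finType) (P : pred T) m (C : T -> 'cV[k]_m) :
  (#|P| < m)%N ->
  exists v : 'rV[k]_m, v != 0 /\ forall a, P a -> v *m C a = 0.
Proof.
move=> Pm; pose B := \matrix_(x < m, z < #|P|) C (enum_val z) x 0.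
have : kermx B != 0.
  rewrite -mxrank_eq0 mxrank_ker subn_eq0 -ltnNge.
  by apply: leq_ltn_trans Pm; exact: rank_leq_col.
case/rowV0Pn=> v /sub_kermxP vB vnz; exists v; split=> // a Pa.
have va : (v *m B) 0 (enum_rank_in (Pa : a \in P) a) = 0 by rewrite vB mxE.
apply/matrixP=> x y; rewrite !ord1 {x y} [RHS]mxE -va !mxE.
by apply: eq_bigr => x _; rewrite mxE enum_rankK_in.
Qed.

Lemma row_free_repeat n m (v : 'rV[k]_m) : (n <= 1)%N -> v != 0 ->
  row_free (\matrix_(x < n, y < m) v 0 y).
Proof.
case: n => [|[|//]] _ vnz; first by rewrite /row_free -leqn0 rank_leq_row.
have -> : \matrix_(x < 1, y < m) v 0 y = v.
  by apply/matrixP=> x y; rewrite mxE ord1.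
by rewrite /row_free rank_rV vnz.
Qed.

(** [conform_mx] transports a vector at the vertex i to the source or target of
    an arrow which is only propositionally equal to i. *)
Lemma mul_conform n m p (v : 'rV[k]_n) (Z : 'M[k]_(m, p)) : m = n ->
  conform_mx (0 : 'rV[k]_m) v *m Z = v *m conform_mx (0 : 'M[k]_(n, p)) Z.
Proof. by move=> e; case: n / e v => v; rewrite !conform_mx_id. Qed.

Lemma conform_neq0 n m (v : 'rV[k]_n) : n = m -> v != 0 ->
  conform_mx (0 : 'rV[k]_m) v != 0.
Proof. by move=> e; case: m / e; rewrite conform_mx_id. Qed.

Lemma row1_eq0 n (u : 'rV[k]_n) :
  (n <= 1)%N -> u *m const_mx 1 = 0 :> 'M_1 -> u = 0.
Proof.
case: n u => [|[|//]] u _ u0; apply/rowP=> y; first by case: y.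
have := congr1 (fun M : 'M_1 => M 0 0) u0.
by rewrite !mxE big_ord1 !mxE mulr1 (ord1 y) => ->.
Qed.

Lemma sigma_le1 (i l : vertex Q) : (sigma i l <= 1)%N.
Proof. by rewrite ffunE; case: eqP. Qed.

(** Each arrow leaving i is a linear form on X_i, or zero; a common zero v of
    these forms spans a simple subrepresentation at i. *)
Lemma full_mul_simple d i (c := d + sigma i : dimv Q) :
  (forall a : arrow Q, src a = i -> c (tgt a) <= 1)%N ->
  (#|[pred a : arrow Q | (src a == i) && (c (tgt a) != 0)]| < c i)%N ->
  ext_mul (full k d) (full k (sigma i)) = full k c.
Proof.
move=> c1 few; apply: (@stable_set_full (ext_mul _ _)).
apply/seteqP; split=> // X _; apply/extensions_subP => //.
change (rep k c) in X.
pose C a : 'cV[k]_(c i) := conform_mx 0 (X a *m const_mx 1 : 'cV_(c (src a))).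
have [v [vnz vC]] := common_kernel C few.
have vX a : src a = i -> conform_mx (0 : 'rV_(c (src a))) v *m X a = 0.
  move=> ai; apply: row1_eq0; first exact: c1.
  have [c0|cn0] := eqVneq (c (tgt a)) 0%N.
    apply/rowP=> x; rewrite [RHS]mxE mxE big1 // => y _.
    by have := ltn_ord y; rewrite [X in (_ < X)%N]c0.
  rewrite -mulmxA mul_conform ?ai //.
  by apply: vC; rewrite /= ai eqxx.
exists (fun l => \matrix_(x, y) (conform_mx (0 : 'rV_(c l)) v) 0 y); split.
  move=> l; have [li|li] := eqVneq l i.
    apply: row_free_repeat; first exact: sigma_le1.
    by apply: conform_neq0 => //; rewrite li.
  have s0 : sigma i l = 0%N by rewrite ffunE (negPf li).
  by rewrite -row_leq_rank (leq_trans _ (leq0n _)) ?s0.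
exists (fun a => 0) => // a; rewrite mul0mx; apply/esym/matrixP=> x y.
have ai : src a = i.
  by apply/eqP; case: x => x /=; rewrite ffunE; case: eqP.
have := congr1 (fun u : 'rV_ _ => u 0 y) (vX a ai).
rewrite !mxE => va; rewrite -[RHS]va.
by apply: eq_bigr => z _; rewrite mxE.
Qed.

(** The dual of [full_mul_simple]: the images of the arrows into i lie in a
    hyperplane of X_i, and the quotient by it is simple. *)
Lemma full_simple_mul i e (c := sigma i + e : dimv Q) :
  (forall a : arrow Q, tgt a = i -> c (src a) <= 1)%N ->
  (#|[pred a : arrow Q | (tgt a == i) && (c (src a) != 0)]| < c i)%N ->
  ext_mul (full k (sigma i)) (full k e) = full k c.
Proof.
move=> c1 few; apply: (@stable_set_full (ext_mul _ _)).
apply/seteqP; split=> // X _; apply/extensions_quotP => //.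
change (rep k c) in X.
pose C a : 'cV[k]_(c i) :=
  conform_mx 0 ((X a)^T *m const_mx 1 : 'cV_(c (tgt a))).
have [v [vnz vC]] := common_kernel C few.
have vX a : tgt a = i -> conform_mx (0 : 'rV_(c (tgt a))) v *m (X a)^T = 0.
  move=> ai; apply: row1_eq0; first exact: c1.
  have [c0|cn0] := eqVneq (c (src a)) 0%N.
    apply/rowP=> x; rewrite [RHS]mxE mxE big1 // => y _.
    by have := ltn_ord y; rewrite [X in (_ < X)%N]c0.
  rewrite -mulmxA mul_conform ?ai //.
  by apply: vC; rewrite /= ai eqxx.
exists (fun l => (\matrix_(x, y) (conform_mx (0 : 'rV_(c l)) v) 0 y)^T); split.
  move=> l; rewrite /row_full mxrank_tr -/(row_free _).
  have [li|li] := eqVneq l i.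
    apply: row_free_repeat; first exact: sigma_le1.
    by apply: conform_neq0 => //; rewrite li.
  have s0 : sigma i l = 0%N by rewrite ffunE (negPf li).
  by rewrite -row_leq_rank (leq_trans _ (leq0n _)) ?s0.
exists (fun a => 0) => // a; rewrite mulmx0; apply/matrixP=> y x.
have ai : tgt a = i.
  by apply/eqP; case: x => x /=; rewrite ffunE; case: eqP.
have := congr1 (fun u : 'rV_ _ => u 0 y) (vX a ai).
rewrite !mxE => va; rewrite -[RHS]va.
by apply: eq_bigr => z _; rewrite !mxE mulrC.
Qed.

Section SerreRelations.
Hypothesis acyclicQ : acyclic Q.
Implicit Types i j : vertex Q.

Lemma tgt_neq_src (a : arrow Q) : tgt a == src a = false.
Proof.
by apply/negP=> aa; have := @acyclicQ [:: a]; rewrite /= aa => /(_ isT).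
Qed.

Lemma mulrn_sigma i n l : (sigma i *+ n) l = ((l == i) * n)%N :> nat.
Proof.
rewrite ffunMnE ffunE; elim: n => [|n IH]; rewrite ?muln0 ?mulnS //.
by rewrite mulrS IH.
Qed.

(** There are no loops at i. *)
Lemma word_nseq i n : word (nseq n i) = full k (sigma i *+ n).
Proof.
elim: n => [|n IH] //=; rewrite IH mulrS full_mul // => a.
rewrite mulrn_sigma ffunE; case: eqP => [ai|]; last by left.
by right; rewrite -ai eq_sym tgt_neq_src.
Qed.

Lemma narrows0 i j (a : arrow Q) :
  narrows i j = 0%N -> src a = i -> tgt a = j -> False.
Proof.
move=> /card0_eq/(_ a); rewrite !inE => nij ai aj.
by rewrite ai aj !eqxx in nij.
Qed.

(** Both sides are R_d for d = (n + 1) sigma_i + sigma_j: the left one as no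
    arrow goes from j to i, the right one as the n arrows from i to j have a
    common kernel vector in dimension n + 1. *)
Lemma serre_word_l i j (n := narrows i j) : narrows j i = 0%N ->
  word (nseq n.+1 i ++ [:: j]) = word (nseq n i ++ [:: j; i]).
Proof.
move=> ji; have [ij|ij] := eqVneq i j.
  by rewrite -ij -(cat1s i [:: i]) catA -(nseqD n 1) addn1.
have -> : [:: j; i] = [:: j] ++ [:: i] by [].
rewrite catA !word_cat !word_nseq /= !ext_mul1r.
have split_ij p : ext_mul (full k (sigma i *+ p)) (full k (sigma j)) =
    full k (sigma i *+ p + sigma j).
  apply: full_mul => a; rewrite mulrn_sigma ffunE.
  have [ai|] := eqVneq (tgt a) i; last by left.
  by right; case: eqP => // aj; case: (narrows0 ji aj ai).
rewrite !split_ij.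
have dE l : (sigma i *+ n + sigma j + sigma i) l =
    ((l == i) * n + (l == j) + (l == i))%N :> nat.
  by rewrite !ffunE mulrn_sigma.
rewrite full_mul_simple.
- by rewrite mulrS -(addrA (sigma i)) (addrC (sigma i)).
- move=> a ai; rewrite dE -ai tgt_neq_src mul0n add0n addn0.
  by case: eqP.
rewrite dE eqxx (negPf ij) mul1n addn0 addn1 ltnS.
rewrite /n /narrows; apply: subset_leq_card.
apply/fintype.subsetP=> a; rewrite !inE => /andP[/eqP ai].
rewrite dE -ai eqxx tgt_neq_src mul0n add0n addn0 /=.
by rewrite eqb0 negbK.
Qed.

(** Both sides are R_d for d = sigma_i + (n + 1) sigma_j: in the right one, the
    n arrows from i to j send the line at i into a hyperplane at j. *)
Lemma serre_word_r i j (n := narrows i j) : narrows j i = 0%N ->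
  word (i :: nseq n.+1 j) = word (j :: i :: nseq n j).
Proof.
move=> ji; have [<- //|ij] := eqVneq i j.
have -> : [:: j, i & nseq n j] = [:: j] ++ ([:: i] ++ nseq n j) by [].
have -> : i :: nseq n.+1 j = [:: i] ++ nseq n.+1 j by [].
rewrite !word_cat !word_nseq /= !ext_mul1r.
have split_ij p : ext_mul (full k (sigma i)) (full k (sigma j *+ p)) =
    full k (sigma i + sigma j *+ p).
  apply: full_mul => a; rewrite mulrn_sigma ffunE.
  have [ai|] := eqVneq (tgt a) i; last by left.
  by right; case: eqP => // aj; case: (narrows0 ji aj ai).
rewrite !split_ij.
have dE l : (sigma j + (sigma i + sigma j *+ n)) l =
    ((l == j) + ((l == i) + (l == j) * n))%N :> nat.
  by rewrite !ffunE mulrn_sigma.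
rewrite full_simple_mul.
- by rewrite mulrS addrCA.
- move=> a aj; rewrite dE -aj eq_sym tgt_neq_src mul0n add0n addn0.
  by case: eqP.
rewrite dE eqxx eq_sym (negPf ij) mul1n !add0n add1n ltnS.
rewrite /n /narrows; apply: subset_leq_card.
apply/fintype.subsetP=> a; rewrite !inE => /andP[/eqP aj].
rewrite dE -aj eqxx (eq_sym (src a)) tgt_neq_src mul0n add0n addn0 /= andbT.
by rewrite eqb0 negbK.
Qed.

End SerreRelations.

End Words.

(** * Universal properties of the free algebra and of quotients *)

Lemma malgC_central (R : comNzRingType) (K : monomType) (c : R)
    (g : {malg R[K]}) : g * c%:MP = c%:MP * g.
Proof.
rewrite !malgM_def fgmulgU fgmulUg; apply: eq_bigr => m _.
by rewrite mulm1 mul1m mulrC.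
Qed.

Lemma malgU_scale (R : comNzRingType) (K : monomType) (c : R) (m : K) :
  << c *g m >> = c *: << m >> :> {malg R[K]}.
Proof. by rewrite -mul_malgC malgM_def fgmulUU mulr1 mul1m. Qed.

Section FreeAlgebras.
Variables (R : comNzRingType) (I : choiceType).

Lemma free_alg_ind (P : free_alg R I -> Prop) :
  P 1 -> (forall x y, P x -> P y -> P (x + y)) ->
  (forall x y, P x -> P y -> P (x * y)) ->
  (forall c x, P x -> P (c *: x)) -> (forall i, P (free_gen R i)) ->
  forall x, P x.
Proof.
move=> P1 PD PM PZ Pgen x; have P0 : P 0 by rewrite -(scale0r 1); exact: PZ.
rewrite (monalgE x); elim: (finmap.enum_fset _) => [|m s IH].
  by rewrite big_nil.
rewrite big_cons; apply: (PD) => //.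
rewrite malgU_scale; apply: PZ; case: m {IH s} => s; elim: s => [|i s IH].
  by have <- : (1 : free_alg R I) = << FMonom [::] >>; first by rewrite -fmoneE.
have -> : << FMonom (i :: s) >> = free_gen R i * << FMonom s >> :> free_alg R I.
  rewrite malgM_def fgmulUU mulr1; congr (<< _ >>).
  by apply: val_inj; rewrite /= fmM fmU.
exact: PM.
Qed.

(** Scalars act through phi, which may change the base ring: this gives maps
    that are semilinear, as needed for the specialization of q. *)
Lemma free_alg_eval (B : nzRingType) (phi : {rmorphism R -> B}) (e : I -> B) :
  (forall c b, phi c * b = b * phi c) ->
  exists F : {rmorphism free_alg R I -> B},
    (forall i, F (free_gen R i) = e i) /\
    forall c x, F (c *: x) = phi c * F x.
Proof.
move=> central; pose h (m : {fmonom I}) := \prod_(a <- (m : seq I)) e a.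
have hM : {morph h : m n / mmul m n >-> m * n} * (h mone = 1).
  by split=> [m n|]; rewrite /h ?fm1 ?big_nil // fmM big_cat.
pose hm : {mmorphism {fmonom I} -> B} :=
  HB.pack h (isMultiplicative.Build _ _ h hM).
pose F : free_alg R I -> B := mmap phi hm.
have FB : zmod_morphism F by move=> x y; exact: mmapB.
have FM : monoid_morphism F.
  have [FM F1] : multiplicative (mmap phi hm).
    by apply: commr_mmap_is_multiplicative => g m m'; exact: central.
  by split.
pose FR : {rmorphism free_alg R I -> B} :=
  HB.pack F (GRing.isZmodMorphism.Build _ _ F FB)
            (GRing.isMonoidMorphism.Build _ _ F FM).
exists FR; split=> [i|c x].
  have -> : FR (free_gen R i) = phi 1 * h (fmu i) by exact: mmapU.
  by rewrite rmorph1 mul1r /h fmU big_seq1.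
exact: mmapZ.
Qed.

End FreeAlgebras.

Lemma ideal_gen_rel (R : comNzRingType) (A : algType R) (rel : set A) r :
  rel r -> ideal_gen rel r.
Proof.
move=> rr; have := ideal_genD 1 1 rr (ideal_gen0 rel).
by rewrite mul1r mulr1 addr0.
Qed.

Lemma quot_lift (R : comNzRingType) (A : algType R) (rel : set A)
    (proper : ~ ideal_gen rel 1) (B : nzRingType) (f : {rmorphism A -> B}) :
  (forall r, rel r -> f r = 0) ->
  exists g : {rmorphism quot_alg proper -> B},
    forall x, g (quot_pi proper x) = f x.
Proof.
move=> frel; pose g (u : quot_alg proper) := f (repr u).
have gE x : g (quot_pi proper x) = f x.
  apply/eqP; rewrite -subr_eq0 -rmorphB; apply/eqP; apply: (ideal_gen_ker frel).
  by apply/(quot_piP proper); rewrite quot_piK.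
have gB : zmod_morphism g.
  move=> u v; rewrite -(quot_piK u) -(quot_piK v) -rmorphB !gE.
  exact: rmorphB.
have gM : monoid_morphism g.
  split=> [|u v]; first by rewrite -(rmorph1 (quot_pi proper)) gE rmorph1.
  rewrite -(quot_piK u) -(quot_piK v) -rmorphM !gE; exact: rmorphM.
pose G : {rmorphism quot_alg proper -> B} :=
  HB.pack g (GRing.isZmodMorphism.Build _ _ g gB)
            (GRing.isMonoidMorphism.Build _ _ g gM).
by exists G.
Qed.

(** * Specialization of the quantum group at q = 0 *)

Lemma qfact_neq0 n : qfact n != 0.
Proof.
rewrite prodf_seq_neq0; apply/allP=> m; rewrite mem_index_iota => /andP[m0 _].
by rewrite -size_poly_gt0 size_XnsubC.
Qed.

Lemma qfactS n : qfact n.+1 = qfact n * ('X^(n.+1) - 1).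
Proof. by rewrite /qfact big_nat_recr. Qed.

Lemma qfact0 : qfact 0 = 1.
Proof. by rewrite /qfact big_geq. Qed.

Lemma qbinomC m n : qbinom m n = qbinom n m.
Proof. by rewrite /qbinom addnC mulrC. Qed.

Lemma qbinom_n0 n : qbinom n 0 = 1.
Proof. by rewrite /qbinom addn0 qfact0 mulr1 divpp ?qfact_neq0. Qed.

Lemma qbinom_n1_at0 n : (qbinom n 1).[0] = 1.
Proof.
rewrite /qbinom addn1 !qfactS qfact0 mul1r expr1 subrX1 mulrA mulrC mulpK.
  by rewrite horner_sum big_ord_recl big1 ?expr0 ?hornerC ?addr0 // => i _;
     rewrite hornerXn expr0n.
by rewrite mulf_neq0 ?qfact_neq0 // -size_poly_gt0 size_XsubC.
Qed.

Lemma sqr_pred_at0 p : (1 < p)%N -> (('X^(p * (p - 1)) : {poly rat}).[0]) = 0.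
Proof. by case: p => [|[|p]] // _; rewrite hornerXn expr0n. Qed.

(** The coefficients of [serre_l] and [serre_r] at q = 0, where n is the number
    of arrows. *)
Definition serre_coef_l (n p : nat) : rat :=
  ((-1) ^+ (n.+1 - p) * 'X^((n.+1 - p) * (n.+1 - p - 1)) *
    qbinom p (n.+1 - p)).[0].

Definition serre_coef_r (n p : nat) : rat :=
  ((-1) ^+ p * 'X^(p * (p - 1)) * qbinom p (n.+1 - p)).[0].

Lemma serre_coef_l_small n p : (p < n)%N -> serre_coef_l n p = 0.
Proof.
move=> pn; rewrite /serre_coef_l !hornerM sqr_pred_at0 ?mulr0 ?mul0r //.
by rewrite ltn_subRL addn1 ltnS.
Qed.

Lemma serre_coef_l1 n : serre_coef_l n n = -1.
Proof.
rewrite /serre_coef_l subSnn muln0 expr0 expr1 mulr1 hornerM qbinom_n1_at0.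
by rewrite mulr1 hornerN hornerC.
Qed.

Lemma serre_coef_l0 n : serre_coef_l n n.+1 = 1.
Proof.
by rewrite /serre_coef_l subnn mul0n !expr0 qbinom_n0 !mulr1 hornerC.
Qed.

Lemma serre_coef_r_small n p : (1 < p)%N -> serre_coef_r n p = 0.
Proof.
by move=> p1; rewrite /serre_coef_r !hornerM sqr_pred_at0 ?mulr0 ?mul0r.
Qed.

Lemma serre_coef_r0 n : serre_coef_r n 0 = 1.
Proof.
by rewrite /serre_coef_r subn0 mul0n !expr0 qbinomC qbinom_n0 !mulr1 hornerC.
Qed.

Lemma serre_coef_r1 n : serre_coef_r n 1 = -1.
Proof.
rewrite /serre_coef_r subSS subn0 muln0 expr0 expr1 mulr1 hornerM qbinomC.
by rewrite qbinom_n1_at0 mulr1 hornerN hornerC.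
Qed.

Lemma sum_top (B : nzRingType) (phi : {rmorphism rat -> B}) (a : nat -> rat)
    (G : nat -> B) n :
  (forall p, (p < n)%N -> a p = 0) -> a n = -1 -> a n.+1 = 1 ->
  \sum_(p < n.+2) phi (a p) * G p = G n.+1 - G n.
Proof.
move=> a0 an anS; rewrite !big_ord_recr big1 => [|p _] /=; last first.
  by rewrite a0 // rmorph0 mul0r.
by rewrite an anS rmorphN rmorph1 add0r mulN1r mul1r addrC.
Qed.

Lemma sum_bottom (B : nzRingType) (phi : {rmorphism rat -> B}) (a : nat -> rat)
    (G : nat -> B) n :
  (forall p, (1 < p)%N -> a p = 0) -> a 0%N = 1 -> a 1%N = -1 ->
  \sum_(p < n.+2) phi (a p) * G p = G 0%N - G 1%N.
Proof.
move=> ap a0 a1; rewrite !big_ord_recl big1 => [|p _] /=; last first.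
  by rewrite ap // rmorph0 mul0r.
by rewrite a0 a1 rmorphN rmorph1 addr0 mulN1r mul1r.
Qed.

Section BaseChange.
Variable Q : quiver.

(** The canonical map u |-> 1 (x) u. *)
Definition iota (u : Uplus Q) : U0plus Q :=
  quot_pi (U0plus_proper (Q := Q)) (free_gen rat u).

Lemma iota1 : iota 1 = 1.
Proof.
rewrite -(rmorph1 (quot_pi (U0plus_proper (Q := Q)))); apply/quot_piP.
by apply: ideal_gen_rel; exact: BaseChange1.
Qed.

Lemma iotaM u v : iota (u * v) = iota u * iota v.
Proof.
rewrite -[RHS]quot_piM; apply/quot_piP.
by apply: ideal_gen_rel; exact: BaseChangeM.
Qed.

Lemma iotaD u v : iota (u + v) = iota u + iota v.
Proof.
rewrite -[RHS](rmorphD (quot_pi _)); apply/quot_piP.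
by apply: ideal_gen_rel; exact: BaseChangeD.
Qed.

Lemma iotaZ c u : iota (c *: u) = c.[0] *: iota u.
Proof.
rewrite -[RHS]quot_piZ; apply/quot_piP.
by apply: ideal_gen_rel; exact: BaseChangeZ.
Qed.

(** Elements of U_0^+ are noncommutative polynomials in the E_i.  The algebra is
    a quotient of the free algebra on the elements u of U^+, so one reduces to
    the elements 1 (x) u first, and then to u = E_i. *)
Lemma U0plus_ind (P : U0plus Q -> Prop) :
  P 1 -> (forall x y, P x -> P y -> P (x + y)) ->
  (forall x y, P x -> P y -> P (x * y)) ->
  (forall c x, P x -> P (c *: x)) -> (forall i, P (U0plus_gen i)) ->
  forall x, P x.
Proof.
move=> P1 PD PM PZ Pgen x; rewrite -(quot_piK x).
elim/free_alg_ind: (repr x) => [|y z Py Pz|y z Py Pz|c y Py|u].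
- by rewrite rmorph1.
- by rewrite rmorphD; exact: PD.
- by rewrite rmorphM; exact: PM.
- by rewrite linearZ; exact: PZ.
rewrite -/(iota u) -(quot_piK u).
elim/free_alg_ind: (repr u) => [|y z Py Pz|y z Py Pz|c y Py|i].
- by rewrite rmorph1 iota1.
- by rewrite rmorphD iotaD; exact: PD.
- by rewrite rmorphM iotaM; exact: PM.
- by rewrite linearZ iotaZ; exact: PZ.
- exact: Pgen.
Qed.

(** Elements e_i satisfying the relations at q = 0 define a map from U^+ that is
    semilinear along q |-> 0, hence one from the base change.  Scalars have to
    act centrally on the target, which need not be an algebra a priori. *)
Lemma U0plus_lift (B : nzRingType) (phi : {rmorphism rat -> B})
    (e : vertex Q -> B) :
  (forall c b, phi c * b = b * phi c) ->
  (forall i j, narrows j i = 0%N -> let n := narrows i j in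
     e i ^+ n.+1 * e j = e i ^+ n * e j * e i) ->
  (forall i j, narrows j i = 0%N -> let n := narrows i j in
     e i * e j ^+ n.+1 = e j * e i * e j ^+ n) ->
  exists F : {rmorphism U0plus Q -> B},
    (forall i, F (U0plus_gen i) = e i) /\ forall c x, F (c *: x) = phi c * F x.
Proof.
move=> central serreL serreR.
pose phi0 : {rmorphism {poly rat} -> B} := phi \o horner_eval 0.
have [F0 [F0gen F0Z]] := free_alg_eval (phi := phi0) e
  (fun c b => central _ b).
have F0rel r : serre_rel r -> F0 r = 0.
  have F0E c i j p p' : F0 (c *: (free_gen _ i ^+ p * free_gen _ j *
      free_gen _ i ^+ p')) = phi c.[0] * (e i ^+ p * e j * e i ^+ p').
    by rewrite F0Z !rmorphM !rmorphXn /= !F0gen.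
  case=> i j ji; rewrite rmorph_sum.
    under eq_bigr do rewrite F0E.
    rewrite (@sum_top _ phi (serre_coef_l (narrows i j))
      (fun p => e i ^+ p * e j * e i ^+ ((narrows i j).+1 - p)) (narrows i j))
      ?serre_coef_l0 ?serre_coef_l1 //; last exact: serre_coef_l_small.
    by rewrite subnn subSnn mulr1 serreL // subrr.
  under eq_bigr do rewrite F0E.
  rewrite (@sum_bottom _ phi (serre_coef_r (narrows i j))
    (fun p => e j ^+ p * e i * e j ^+ ((narrows i j).+1 - p)) (narrows i j))
    ?serre_coef_r0 ?serre_coef_r1 //; last exact: serre_coef_r_small.
  by rewrite subn0 subSS subn0 mul1r serreR // subrr.
have [F1 F1E] := quot_lift (@serre_proper Q) F0rel.
have F1Z c u : F1 (c *: u) = phi0 c * F1 u.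
  by rewrite -(quot_piK u) -linearZ !F1E F0Z.
have [F2 [F2gen F2Z]] := free_alg_eval F1 central.
have F2rel r : base_change_rel (horner_eval 0) r -> F2 r = 0.
  case=> [|a b|a b|c a].
  - by rewrite rmorphB F2gen !rmorph1 subrr.
  - by rewrite rmorphB (rmorphM F2) !F2gen (rmorphM F1) subrr.
  - by rewrite rmorphB (rmorphD F2) !F2gen (rmorphD F1) subrr.
  - by rewrite rmorphB F2Z !F2gen F1Z subrr.
have [F FE] := quot_lift (@U0plus_proper Q) F2rel.
exists F; split=> [i|c x]; first by rewrite FE F2gen F1E F0gen.
by rewrite -(quot_piK x) -linearZ !FE F2Z.
Qed.

End BaseChange.

Lemma prod_nseq (B : nzRingType) (I : Type) (e : I -> B) n i :
  \prod_(l <- nseq n i) e l = e i ^+ n.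
Proof. by rewrite big_nseq -Monoid.iteropE. Qed.

Lemma U0plus_lift_words (k : closedFieldType) (Q : quiver) (B : nzRingType)
    (phi : {rmorphism rat -> B}) (e : vertex Q -> B) :
  acyclic Q -> (forall c b, phi c * b = b * phi c) ->
  (forall u v, word k u = word k v ->
     \prod_(i <- u) e i = \prod_(i <- v) e i) ->
  exists F : {rmorphism U0plus Q -> B},
    (forall i, F (U0plus_gen i) = e i) /\ forall c x, F (c *: x) = phi c * F x.
Proof.
move=> acyclicQ central wordE.
apply: U0plus_lift => // i j ji n.
  have := wordE _ _ (serre_word_l k acyclicQ ji).
  by rewrite !big_cat !prod_nseq !big_cons !big_nil /= !mulr1 mulrA.
have := wordE _ _ (serre_word_r k acyclicQ ji).
by rewrite big_cons prod_nseq !big_cons prod_nseq mulrA.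
Qed.

(** * The homomorphism to the monoid ring *)

Section MonoidRing.
Variables (k : closedFieldType) (Q : quiver).

Definition comp_word (w : seq (vertex Q)) : composition_monoid k Q :=
  foldr (fun i => comp_mul (comp_gen k i)) (comp_one k Q) w.

Lemma val_comp_word w : val (comp_word w) = word k w.
Proof. by elim: w => //= i w <-. Qed.

Lemma comp_word_onto (A : composition_monoid k Q) : exists w, A = comp_word w.
Proof.
have /asboolP/composition_set_word[w wE] := valP A.
by exists w; apply: val_inj; rewrite val_comp_word.
Qed.

Local Notation monom A := (<< A >> : {malg rat[composition_monoid k Q]}).

Lemma monomM A B : monom (comp_mul A B) = monom A * monom B.
Proof. by rewrite malgM_def fgmulUU mulr1. Qed.

Lemma monom_word w : monom (comp_word w) = \prod_(i <- w) monom (comp_gen k i).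
Proof.
elim: w => [|i w IH]; first by rewrite big_nil.
by rewrite big_cons -IH -monomM.
Qed.

Lemma monom_word_eq u v : word k u = word k v ->
  \prod_(i <- u) monom (comp_gen k i) = \prod_(i <- v) monom (comp_gen k i).
Proof.
move=> uv; rewrite -!monom_word; congr (<< _ >>).
by apply: val_inj; rewrite !val_comp_word.
Qed.

End MonoidRing.

Theorem proposition4p3 (k : closedFieldType) (Q : quiver)
    (char0 : [pchar k] =i pred0) (acyclicQ : acyclic Q) :
  exists eta : {lrmorphism U0plus Q -> {malg rat[composition_monoid k Q]}},
    [/\ forall i : vertex Q, eta (U0plus_gen i) = << comp_gen k i >>,
        forall y, exists x, eta x = y
      & forall eta' : {lrmorphism U0plus Q -> {malg rat[composition_monoid k Q]}},
          (forall i : vertex Q, eta' (U0plus_gen i) = << comp_gen k i >>) ->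
          eta' =1 eta].
Proof.
pose B := {malg rat[composition_monoid k Q]}.
pose e i : B := << comp_gen k i >>.
have [F [Fgen FZ]] := U0plus_lift_words (phi := @malgC _ rat) (e := e) acyclicQ
  (fun c b => esym (malgC_central c b)) (@monom_word_eq k Q).
have Fword w : F (\prod_(i <- w) U0plus_gen i) = << comp_word k w >>.
  elim: w => [|i w IH]; first by rewrite big_nil rmorph1.
  rewrite big_cons rmorphM IH Fgen.
  exact: esym (monomM (comp_gen k i) (comp_word k w)).
have Fonto y : exists x, F x = y.
  rewrite (monalgE y); elim: (finmap.enum_fset _) => [|m s [x xE]].
    by exists 0; rewrite big_nil rmorph0.
  have [w ->] := comp_word_onto m.
  exists (mcoeff (comp_word k w) y *: \prod_(i <- w) U0plus_gen i + x).
  rewrite big_cons rmorphD xE FZ mul_malgC Fword.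
  by rewrite (malgU_scale (mcoeff (comp_word k w) y)).
pose f : U0plus Q -> B := F.
have fB : zmod_morphism f by exact: (rmorphB F).
have fM : monoid_morphism f by split; [exact: (rmorph1 F) | exact: (rmorphM F)].
have fZ : scalable f by move=> c x; rewrite /f FZ mul_malgC.
pose eta : {lrmorphism U0plus Q -> B} :=
  HB.pack f (GRing.isZmodMorphism.Build _ _ f fB)
            (GRing.isMonoidMorphism.Build _ _ f fM)
            (GRing.isScalable.Build _ _ _ _ f fZ).
exists eta; split=> [i|y|eta' eta'gen x]; [exact: Fgen|exact: Fonto|].
elim/U0plus_ind: x => [|x y xE yE|x y xE yE|c x xE|i].
- by rewrite !rmorph1.
- by rewrite !rmorphD /= xE yE.
- by rewrite !rmorphM /= xE yE.
- by rewrite !linearZ /= xE.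
- by rewrite eta'gen; exact/esym/Fgen.
Qed.
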